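(* Assume the Continuum Hypothesis. Then for every positive integer $k$ there exists an independent set $\{x_\xi : \xi<\mathfrak{c}\}\subseteq\{0,1\}^{\mathfrak{c}}$ such that the subgroup $G=\langle\{x_\xi:\xi<\mathfrak{c}\}\rangle$ of $\{0,1\}^{\mathfrak{c}}$ generated by this set (with the subspace topology) is HFD in $\{0,1\}^{\mathfrak{c}}$ and has property $(P)$, the power $G^k$ is countably compact, and the power $G^{k+1}$ is not selectively pseudocompact. In particular, there is a topological group whose $k$-th power is countably compact but whose $(k+1)$-st power is not selectively pseudocompact.
   Context: All spaces are Tychonoff and all topological groups are Hausdorff. $\mathfrak{c}$ is the cardinality of the continuum, regarded as an initial ordinal. $\{0,1\}^{\mathfrak{c}}$ is the product group $(\mathbb{Z}/2)^{\mathfrak{c}}$ with the product topology ($\{0,1\}$ discrete), and $x_\xi$ is indexed injectively by $\xi<\mathfrak{c}$. ''Independent'' means linearly independent over the two-element field. A space $X$ is countably compact if every infinite subset of $X$ has an accumulation point in $X$. A space $X$ is selectively pseudocompact if for each sequence $(U_n)_{n\in\mathbb{N}}$ of pairwise disjoint nonempty open subsets of $X$ there are points $x_n\in U_n$ ($n\in\mathbb{N}$) and a point $x\in X$ such that $x$ is an accumulation point of $\{x_n:n\in\mathbb{N}\}$. Let $\lambda$ be an infinite cardinal, $X=\prod_{\alpha<\lambda}X_\alpha$ a topological product, and $Y\subseteq X$ infinite. $Y$ is finally dense in $X$ if there is $\beta<\lambda$ such that the projection of $Y$ to $\prod_{\beta\le\alpha<\lambda}X_\alpha$ is dense in $\prod_{\beta\le\alpha<\lambda}X_\alpha$.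 $Y$ is hereditarily finally dense (HFD) in $X$ if every infinite subset of $Y$ is finally dense in $X$. $Y$ has property $(P)$ if for every countably infinite $J\subseteq\lambda$ the projection $\pi_J:X\to\prod_{\alpha\in J}X_\alpha$ satisfies $\pi_J[Y]=\prod_{\alpha\in J}X_\alpha$. *)

(* Defs.v *)
From HB Require Import structures.
From mathcomp Require Import all_boot all_algebra.
From mathcomp Require Import all_classical all_reals all_analysis.
From mathcomp Require wochoice.

Set Implicit Arguments.
Unset Strict Implicit.
Unset Printing Implicit Defensive.

Import GRing.Theory.

Local Open Scope classical_set_scope.
Local Open Scope card_scope.
Local Open Scope ring_scope.

(* The continuum is represented by the cardinality of the power set of nat. *)
Definition continuum_hypothesis : Prop :=
  forall A : set (set nat), countable A \/ A #= [set: set nat].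

(* (I, le) is order-isomorphic to the least ordinal of cardinality continuum:
   a well-order of that cardinality all of whose proper initial segments have
   strictly smaller cardinality. Elements of I stand for the ordinals below
   the continuum, and le for the non-strict order. *)
Definition continuum_ordinal (I : Type) (le : rel I) : Prop :=
  [/\ wochoice.well_order le,
      [set: I] #= [set: set nat] &
      forall i : I, ~ ([set: set nat] #<= [set j | le j i /\ j <> i])].

Lemma continuum_ordinal_exists :
  exists (I : Type) (le : rel I), continuum_ordinal le.
Proof.
pose T : eqType := {classic set nat}.
have [R Rwo] := wochoice.well_ordering_principle T.
have Rmin (A : set T) : A !=set0 -> exists2 z, A z & forall y, A y -> R z y.
  move=> [a Aa]; have [|z [[Az zmin] _]] := Rwo (mem A).
    by exists a; apply/mem_set.
  by exists z => [|y Ay]; [exact/set_mem | apply/zmin/mem_set].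
have Rtot x y : R x y || R y x.
  have [z [->|->] zmin] := Rmin [set x; y] (ex_intro _ x (or_introl erefl)).
    by rewrite (zmin y)//; right.
  by rewrite (zmin x) ?orbT//; left.
have Ranti x y : R x y -> R y x -> x = y.
  move=> Rxy Ryx; have [|z [_ zu]] := Rwo (mem [set x; y]).
    by exists x; apply/mem_set; left.
  have m w : (w = x \/ w = y) -> z = w.
    move=> wE; apply: zu; split; first exact/mem_set.
    have Rrefl u : R u u by have := Rtot u u; rewrite orbb.
    by move=> u /set_mem[->|->]; case: wE => ->.
  by rewrite -(m x) ?(m y)//; [right|left].
have Rtr x y z : R x y -> R y z -> R x z.
  move=> Rxy Ryz.
  have [w [[->|->]|->] wmin] :=
    Rmin ([set x; y] `|` [set z]) (ex_intro _ x (or_introl (or_introl erefl))).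
  - by apply: wmin; right.
  - by rewrite (Ranti x y Rxy) //; apply: wmin; left; left.
  - by rewrite -(Ranti y z Ryz) //; apply: wmin; left; right.
pose seg i := [set j | R j i /\ j <> i].
suff [A [Ac Ad An]] : exists A : set T, [/\ [set: set nat] #<= A,
    forall i j, A i -> R j i -> A j &
    forall i, A i -> ~ ([set: set nat] #<= seg i)].
  exists (set_type A), (fun i j => R (\val i) (\val j)); split.
  - move=> B [b Bb].
    have [z Bz zmin] : exists2 z, z \in B & forall y, y \in B -> R (\val z) (\val y).
      have [z [z' Bz <-] zmin] := Rmin (\val @` [set` B])
        (ex_intro _ (\val b) (ex_intro2 _ _ b (Bb : [set` B] b) erefl)).
      by exists z' => // y By; apply: zmin; exists y.
    exists z; split=> [//|y [By ymin]]; apply/val_inj/Ranti; first exact: zmin.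
    exact: ymin.
  - have Ae : [set: A] #= A.
      have vA : (fun x : A => \val x) @` setT = A.
        apply/seteqP; split=> [_ [x _ <-]|x Ax]; first exact: set_valP.
        by exists (exist _ x (mem_set Ax)).
      have : (fun x : A => \val x) @` setT #= [set: A].
        by apply: inj_card_eq => x y _ _; exact: val_inj.
      by rewrite vA card_eq_sym.
    rewrite (card_eql Ae) card_eq_le Ac andbT.
    exact: (@subset_card_le (set nat) A setT).
  - move=> i Ni; apply: (An (\val i)); first exact: set_valP.
    apply: (card_le_trans Ni).
    rewrite -(card_le_eql (inj_card_eq (f := fun x : A => \val x)
      (fun x y _ _ => @val_inj _ _ _ x y))).
    apply: subset_card_le => _ [x [Rx xi] <-].
    by split=> // /val_inj.
have [[i0 Bi0]|noB] := pselect (exists i, [set: set nat] #<= seg i).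
  have [i Bi imin] := Rmin [set i | [set: set nat] #<= seg i] (ex_intro _ i0 Bi0).
  exists (seg i); split=> // [j l [Rji ji] Rlj|j [Rji ji] Bj].
    split; first exact: Rtr Rlj Rji.
    by move=> li; apply: ji; apply: Ranti => //; rewrite -li.
  by apply: ji; apply: Ranti => //; exact: imin.
exists setT; split=> // i _ Bi; apply: noB; exists i; exact: Bi.
Qed.

Section Spaces.
Variable X : topologicalType.

Definition countably_compact : Prop :=
  forall A : set X, infinite_set A -> limit_point A !=set0.

Definition selectively_pseudocompact : Prop :=
  forall U : nat -> set X,
    (forall n, open (U n)) -> (forall n, U n !=set0) -> trivIset setT U ->
    exists2 x : nat -> X,
      (forall n, U n (x n)) & limit_point (range x) !=set0.

Definition power_space (k : nat) : topologicalType :=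
  prod_topology (fun _ : 'I_k => X).

End Spaces.

Section Products.
Variables (I : Type) (le : rel I) (X : I -> topologicalType).

Definition restrict (J : set I) (x : prod_topology X) :
    prod_topology (fun j : J => X (\val j)) :=
  fun j => x (\val j).

Definition finally_dense (Y : set (prod_topology X)) : Prop :=
  exists b : I, dense (restrict (J := [set a | le b a]) @` Y).

Definition hereditarily_finally_dense (Y : set (prod_topology X)) : Prop :=
  infinite_set Y /\
  forall Z : set (prod_topology X),
    Z `<=` Y -> infinite_set Z -> finally_dense Z.

Definition property_P (Y : set (prod_topology X)) : Prop :=
  forall J : set I, J #= [set: nat] -> restrict (J := J) @` Y = setT.

End Products.

(* {0,1}^I; bool carries the discrete topology and the field structure of F_2
   (addition is addb). *)
Definition cube (I : Type) := prod_topology (fun _ : I => bool).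

HB.instance Definition _ (I : Type) := Topological.on (cube I).
HB.instance Definition _ (I : Type) :=
  GRing.Lmodule.copy (cube I) (I -> bool^o).

Definition linearly_independent (F : fieldType) (V : lmodType F) (S : set V) :
    Prop :=
  forall (n : nat) (v : 'I_n -> V) (a : 'I_n -> F),
    injective v -> (forall i, S (v i)) ->
    \sum_(i < n) a i *: v i = 0 -> forall i, a i = 0.

Definition subgroup_generated (V : zmodType) (S : set V) : set V :=
  smallest (fun H : set V => zmod_closed [in H]) S.

#[short(type="preTopologicalGroupType")]
HB.structure Definition PreTopologicalGroup := {G of Topological G & Group G}.

HB.mixin Record PreTopologicalGroup_isTopologicalGroup G
    of PreTopologicalGroup G := {
  mulg_continuous : continuous (fun x : G * G => (x.1 * x.2)%g);
  invg_continuous : continuous (fun x : G => (x^-1)%g)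
}.

#[short(type="topologicalGroupType")]
HB.structure Definition TopologicalGroup :=
  {G of PreTopologicalGroup G & PreTopologicalGroup_isTopologicalGroup G}.

(* Main.v *)
Require Import Defs.
From HB Require Import structures.
From mathcomp Require Import all_boot all_algebra.
From mathcomp Require Import all_classical all_reals all_analysis.

(** Every element of the group to be built is a finite sum of generators, so
the group is given by an I x I matrix Phi over F_2: coordinate [a] of generator
[x] is [Phi a x].  Row [a] extends to a linear functional on the free F_2-space
V over I, and a vector v of V has coordinates [a |-> (Phi a)(v)].  The rows are
chosen by recursion on [a].  Since proper initial segments of I are countable
under the continuum hypothesis, row [a] has to meet countably many
requirements, each coming from a bookkeeping [e] on I which takes every value
cofinally often ([ordinal_enumeration]).  There are four kinds.

- Entries [Phi a x] with [a <= x] are free to copy a prescribed pattern on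
countably many coordinates below [x].  This gives property (P).

- Genericity: call a family of sequences of vectors, with at most k members,
escaping if each nonzero combination of its members leaves every finite set.
Row [a] takes every tuple of values infinitely often on each escaping family
coded by an index below [a] and supported below [a], even along any infinite set
of positions at which finitely many earlier rows take given values.  By
induction on coordinates an escaping family is therefore dense beyond some
stage.  For one sequence this is the HFD property.  For k sequences it gives countable compactness of the k-th
power: below that stage take a limit along an ultrafilter, realize it in the
group by (P), and above it every value is a limit value.  If a family is not
escaping, then along an infinite set of positions one member is determined by the
others up to a constant, so induction on the number of members applies
([accumulation_exists]).

- Avoidance: let g_0, g_1, ... be independent modulo h_0, ..., h_k, and cut the
g_l into blocks of length k+1.  One row vanishes on all h_i but on no whole
block.

- Separation: each nonzero vector has the value 1 under some row
([separating_functional]), so the generators are independent.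

Genericity and avoidance are compatible because k < k+1.  In a basis containing
all g_l a functional is an arbitrary function on the basis; forcing the values
of a family of at most k vectors requires changing it at no more than k basis
elements ([solve_on_small_set]), which cannot exhaust a block, and it takes the value 1
everywhere else ([generic_extension], [generic_functional]).

The (k+1)-st power is not selectively pseudocompact: fix distinct coordinates
c_0, c_1, ... and let U_n be the set of (z_0, ..., z_k) such that coordinate c_j
of z_i is 1 exactly when j = n(k+1)+i, for all j < (n+1)(k+1).  Points chosen in
the U_n are, read as one sequence, in echelon form.  Hence an accumulation point
h has all its coordinates c_j equal to 0, the chosen points are independent
modulo h, and the avoiding row separates h from all of them. *)

Set Implicit Arguments.
Unset Strict Implicit.
Unset Printing Implicit Defensive.

Import GRing.Theory.

Local Open Scope classical_set_scope.
Local Open Scope card_scope.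

(** * Vectors over F_2 as lists *)

Section Parity.
Variable B : eqType.
Implicit Types (s t : seq B) (phi psi : B -> bool) (b : B).

(** Vectors of the free F_2-space over [B] are lists, read modulo even
multiplicities; concatenation is addition.  [parity phi] is the linear functional
with value [phi b] on the basis vector [b]. *)
Definition parity phi s := odd (count phi s).

Definition coef b s := parity (pred1 b) s.

Definition same_vec s t := forall b, coef b s = coef b t.

Lemma parity_cat phi s t : parity phi (s ++ t) = parity phi s (+) parity phi t.
Proof. by rewrite /parity count_cat oddD. Qed.

Lemma parity_cons phi b s : parity phi (b :: s) = phi b (+) parity phi s.
Proof. by rewrite /parity /= oddD; case: (phi b). Qed.

Lemma parityD phi psi s :
  parity (fun b => phi b (+) psi b) s = parity phi s (+) parity psi s.
Proof. by elim: s => // b s IH; rewrite !parity_cons IH addbACA. Qed.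

Lemma eq_parity_in phi psi s :
  {in s, phi =1 psi} -> parity phi s = parity psi s.
Proof. by rewrite /parity => /eq_in_count ->. Qed.

Lemma parity0 s : parity (fun=> false) s = false.
Proof. by rewrite /parity count_pred0. Qed.

Lemma coef_cat b s t : coef b (s ++ t) = coef b s (+) coef b t.
Proof. exact: parity_cat. Qed.

Lemma coef_cons b c s : coef b (c :: s) = (c == b) (+) coef b s.
Proof. exact: parity_cons. Qed.

Lemma coef_nil b : coef b [::] = false.
Proof. by []. Qed.

Lemma coef_notin b s : b \notin s -> coef b s = false.
Proof. by move=> /count_memPn; rewrite /coef /parity => ->. Qed.

Lemma coef_in b s : coef b s -> b \in s.
Proof. by apply: contraTT => /coef_notin ->. Qed.

(** All occurrences of one basis vector are removed at a time, which leaves the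
other coefficients unchanged. *)
Lemma parity_coef0 phi s :
  (forall b, coef b s -> phi b = false) -> parity phi s = false.
Proof.
have [n] := ubnP (size s); elim: n s => // n IH [//|b s] /= ltn h.
pose s' := [seq c <- b :: s | c != b].
have szs' : size s' < n.
  apply: leq_ltn_trans (_ : size s < n) => //.
  by rewrite size_filter /= eqxx /= count_size.
have cs' c : coef c s' = if c == b then false else coef c (b :: s).
  rewrite /coef /parity /s' count_filter.
  case: (eqVneq c b) => [->|cb].
    by rewrite (@eq_count _ _ pred0) ?count_pred0// => x /=; case: (x == b).
  congr odd; apply: eq_count => x /=.
  by case: (eqVneq x c) => [->|] //=; rewrite cb.
have ps' : parity phi (b :: s) = (phi b && coef b (b :: s)) (+) parity phi s'.
  rewrite /s'; elim: (b :: s) => [|c u IHu]; first by rewrite andbF.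
  rewrite parity_cons IHu coef_cons /=.
  case: (eqVneq c b) => [->|cb] /=; last by rewrite parity_cons addbCA.
  by case: (phi b); case: (coef b u); case: (parity phi _).
rewrite ps' IH// => [|c]; last by rewrite cs'; case: eqP => // _; exact: h.
by case: (boolP (coef b (b :: s))) => [/h ->|]; rewrite ?andbF.
Qed.

Lemma eq_parity phi psi s :
  (forall b, coef b s -> phi b = psi b) -> parity phi s = parity psi s.
Proof.
move=> h; have := @parity_coef0 (fun b => phi b (+) psi b) s.
rewrite parityD; case: (parity phi s); case: (parity psi s) => //= H;
  by rewrite H// => b /h ->; rewrite addbb.
Qed.

Lemma same_vec_parity phi s t : same_vec s t -> parity phi s = parity phi t.
Proof.
move=> st; have := @parity_coef0 phi (s ++ t).
rewrite parity_cat; case: (parity phi s); case: (parity phi t) => //= H;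
  by rewrite H// => b; rewrite coef_cat st addbb.
Qed.

Lemma parity_flip phi b c s :
  parity (fun x => phi x (+) ((x == b) && c)) s
  = parity phi s (+) (coef b s && c).
Proof.
case: c; rewrite ?andbT ?andbF ?addbF.
  rewrite -parityD; apply: eq_parity_in => x _ /=; by rewrite andbT.
by apply: eq_parity_in => x _; rewrite andbF addbF.
Qed.

Definition comb (lam : nat -> bool) (J : seq nat) (v : nat -> seq B) :=
  flatten [seq v i | i <- J & lam i].

Lemma parity_comb phi lam J v :
  parity phi (comb lam J v) =
  odd (count (fun i => lam i && parity phi (v i)) J).
Proof.
elim: J => // i J IH; rewrite /comb /=.
by case: (lam i) => //=; rewrite parity_cat IH oddD; case: (parity phi (v i)).
Qed.

(** Gaussian elimination: the vectors [v i], [i] in [J], are independent modulo the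
span of [S], so each step finds a pivot outside [S], clears it from the other
vectors and finally adjusts [phi] at the pivot.  At most one pivot is spent per
vector, so [phi] changes at no more than [size J] places. *)
Lemma solve_on_small_set J : uniq J -> forall (v : nat -> seq B) (S : seq B),
  (forall lam, has lam J -> exists2 b, b \notin S & coef b (comb lam J v)) ->
  forall phi (p : nat -> bool),
  exists (P : seq B) psi, [/\ size P <= size J,
    {in P, forall b, b \notin S},
    forall b, b \notin P -> psi b = phi b &
    {in J, forall i, parity psi (v i) = p i}].
Proof.
elim: J => [|i0 J IH] /= => [_|/andP[i0J uJ]] v S indep phi p.
  by exists [::], phi.
have [b bS bi0] : exists2 b, b \notin S & coef b (v i0).
  have [|b bS] := indep (pred1 i0); first by rewrite /= eqxx.
  rewrite {1}/coef parity_comb /= eqxx /= (@eq_in_count _ _ pred0) ?count_pred0.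
    by rewrite addn0 oddb => cb; exists b.
  by move=> j jJ /=; case: eqP => // ji; rewrite -ji jJ in i0J.
(* the vectors cleared at the pivot [b] *)
pose v' i := if coef b (v i) then v i ++ v i0 else v i.
have pv' ph i : parity ph (v' i) = parity ph (v i) (+) (coef b (v i) && parity ph (v i0)).
  by rewrite /v'; case: (coef b (v i)); rewrite ?parity_cat ?addbF.
have bv' i : coef b (v' i) = false.
  by rewrite {1}/coef pv' -!/(coef b _) bi0 andbT addbb.
have [|P [psi [szP PS psiP psiJ]]] := IH uJ v' (b :: S) _ phi
    (fun i => p i (+) (coef b (v i) && p i0)).
  move=> lam hlam.
  (* the multiplicity of [v i0] in the combination of the cleared vectors *)
  pose c0 := odd (count (fun i => lam i && coef b (v i)) J).
  have [|c cS] := indep (fun i => if i == i0 then c0 else lam i).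
    apply/orP; right; move: hlam => /hasP[j jJ lj]; apply/hasP; exists j => //.
    by case: eqP => // ji; rewrite -ji jJ in i0J.
  have E : coef c (comb (fun i => if i == i0 then c0 else lam i) (i0 :: J) v)
     = coef c (comb lam J v').
    rewrite /coef !parity_comb /= eqxx oddD.
    rewrite (@eq_in_count _ _ (fun i => lam i && parity (pred1 c) (v i)) J); last first.
      by move=> j jJ; case: eqP => // ji; rewrite -ji jJ in i0J.
    rewrite /c0; elim: (J) => [|j K IHK] //=.
    rewrite !oddD -IHK pv' !oddb /coef.
    case: (lam j); case: (parity _ (v j)); case: (parity _ (v i0)); case: (parity _ (v j));
       case: (odd (count _ K)); case: (odd (count _ K)) => //=.
  rewrite E => cc; exists c => //; rewrite inE negb_or cS andbT.
  apply: contraTneq cc => ->; rewrite /coef parity_comb.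
  rewrite (@eq_count _ _ pred0) ?count_pred0// => j /=.
  by rewrite -/(coef b _) bv' andbF.
exists (b :: P), (fun x => psi x (+) ((x == b) && (p i0 (+) parity psi (v i0)))).
have par0 :
    parity (fun x => psi x (+) ((x == b) && (p i0 (+) parity psi (v i0)))) (v i0) = p i0.
  by rewrite parity_flip bi0 /= addbCA addbb addbF.
split=> //.
- by move=> x; rewrite inE => /predU1P[->//|/PS]; rewrite inE negb_or => /andP[].
- move=> x; rewrite inE negb_or => /andP[/negPf -> xP] /=.
  by rewrite addbF psiP.
- move=> i; rewrite inE => /predU1P[->//|iJ].
  have : parity (fun x => psi x (+) ((x == b) && (p i0 (+) parity psi (v i0)))) (v' i)
      = p i (+) (coef b (v i) && p i0).
    by rewrite parity_flip bv' addbF psiJ.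
  by rewrite pv' par0 => /addIb.
Qed.

End Parity.

(** * Functionals that are generic for small families and avoid large blocks *)

(** Every nonzero combination of the sequences [f _ i], [i] in [J], leaves each
finite-dimensional coordinate subspace after finitely many terms. *)
Definition escaping_family (B : eqType) (J : seq nat) (f : nat -> nat -> seq B) :=
  forall (lam : nat -> bool) (S : seq B), has lam J ->
  finite_set [set n | forall b, coef b (comb lam J (f n)) -> b \in S].

Lemma eq_comb (B : eqType) lam lam' J (v : nat -> seq B) :
  {in J, lam =1 lam'} -> comb lam J v = comb lam' J v.
Proof. by move=> h; rewrite /comb (eq_in_filter h). Qed.

(** Only the restriction of [lam] to [J] matters, so finitely many combinations
have to be considered. *)
Lemma escaping_family_avoid (B : eqType) J (f : nat -> nat -> seq B) (S : seq B) :
  escaping_family J f ->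
  finite_set [set n | exists2 lam : nat -> bool, has lam J &
    forall b, coef b (comb lam J (f n)) -> b \in S].
Proof.
move=> fJ.
pose lamof (m : (size J).-tuple bool) i := nth false m (index i J).
have lamE lam : {in J, lam =1 lamof (map_tuple lam (in_tuple J))}.
  move=> i iJ; rewrite /lamof /= (nth_map 0) ?index_mem// nth_index//.
apply: (@sub_finite_set _ _ (\bigcup_(m in [set: (size J).-tuple bool])
  [set n | has (lamof m) J /\ forall b, coef b (comb (lamof m) J (f n)) -> b \in S])).
  move=> n /= [lam hlam h]; exists (map_tuple lam (in_tuple J)) => //=; split.
    by rewrite -(eq_in_has (lamE lam)).
  by move=> b; rewrite -(eq_comb _ (lamE lam)); exact: h.
apply: bigcup_finite => // m _.
have [hm|hm] := boolP (has (lamof m) J).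
  by apply: sub_finite_set (fJ _ S hm) => n [].
by apply: sub_finite_set (finite_set0 nat) => n [].
Qed.

Section Core.
(** [blk b] is the block containing [b], or the empty list when [b] lies in no
block. *)
Variables (B : eqType) (k : nat) (blk : B -> seq B).
Hypothesis blk_refl : forall b, blk b != [::] -> b \in blk b.
Hypothesis blk_eq : forall b c, c \in blk b -> blk c = blk b.
Hypothesis blk_uniq : forall b, uniq (blk b).
Hypothesis blk_size : forall b, blk b != [::] -> k < size (blk b).

(** A state is a finite set of settled basis vectors with the current functional.
Settled sets are unions of blocks, up to vectors outside every block, and the
functional is 1 on everything unsettled, so that the unsettled blocks are
avoided for free. *)
Definition good_state (s : seq B * (B -> bool)) :=
  [/\ {in s.1, forall b, {subset blk b <= s.1}},
      (forall b, b \notin s.1 -> s.2 b = true) &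
      (forall b, blk b != [::] -> has s.2 (blk b))].

Definition state_extends (s t : seq B * (B -> bool)) :=
  {subset s.1 <= t.1} /\ {in s.1, t.2 =1 s.2}.

(** A block meeting the settled set is already treated.  Any other block has more
than [k] elements, while the functional is changed at no more than [k] places:
it keeps the value 1 somewhere on the block. *)
Lemma generic_extension_step (J : seq nat) (f : nat -> nat -> seq B) (A : set nat)
    (p : nat -> bool) s :
  uniq J -> size J <= k -> escaping_family J f -> infinite_set A -> good_state s ->
  exists t, [/\ good_state t, state_extends s t & exists n, [/\ A n,
    {in J, forall i, {subset f n i <= t.1}} &
    {in J, forall i, parity t.2 (f n i) = p i}]].
Proof.
case: s => S phi uJ szJ fJ Ainf [/= Sclosed Sout Sblk].
have [n An nS] : exists2 n, A n & forall lam : nat -> bool, has lam J ->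
    exists2 b, b \notin S & coef b (comb lam J (f n)).
  have := escaping_family_avoid S fJ; set bad := [set _ | _] => fbad.
  have [n [An nbad]] := infinite_setN0 (infinite_setD Ainf fbad).
  exists n => // lam hlam; apply: contrapT => H; apply: nbad; exists lam => // b cb.
  by apply: contrapT => /negP bS; apply: H; exists b.
have [P [psi [szP PS psiP psiJ]]] := solve_on_small_set uJ nS phi p.
pose L := P ++ flatten [seq f n i | i <- J].
pose S' := S ++ flatten [seq b :: blk b | b <- L].
have SS' : {subset S <= S'} by move=> b; rewrite mem_cat => ->.
have LS' : {subset L <= S'}.
  move=> b bL; rewrite mem_cat; apply/orP; right.
  by apply/flattenP; exists (b :: blk b); rewrite ?mem_head//; apply/mapP; exists b.
exists (S', psi); split; first split => /=.
- move=> b; rewrite mem_cat => /orP[bS c /(Sclosed _ bS)/SS' //|].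
  move=> /flattenP[_ /mapP[c cL ->]]; rewrite inE => bc d db.
  rewrite mem_cat; apply/orP; right.
  apply/flattenP; exists (c :: blk c); first by apply/mapP; exists c.
  rewrite inE; case/predU1P: bc => [<-|bc]; first by rewrite db orbT.
  by rewrite -(blk_eq bc) db orbT.
- move=> b bS'; rewrite psiP; last by apply: contra bS' => bP; apply: LS'; rewrite mem_cat bP.
  by apply: Sout; apply: contra bS'; exact: SS'.
- move=> b b0; have [/hasP[c cb cS]|/hasPn noS] := boolP (has (fun c => c \in S) (blk b)).
    have /hasP[d db phid] := Sblk _ b0.
    apply/hasP; exists d => //; rewrite psiP//; apply/negP => /PS/negP; apply.
    by apply: (Sclosed _ cS); rewrite (blk_eq cb).
  have /allPn[c cb cP] : ~~ all (fun c => c \in P) (blk b).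
    apply/negP => /allP sub; have := uniq_leq_size (blk_uniq b) sub.
    by rewrite leqNgt (leq_ltn_trans szP)// (leq_ltn_trans szJ)// blk_size.
  by apply/hasP; exists c => //; rewrite psiP// Sout// noS.
- split=> //= b bS; rewrite psiP//; by apply/negP => /PS/negP; apply.
exists n; split=> // i iJ b bf; apply: LS'; rewrite mem_cat; apply/orP; right.
by apply/flattenP; exists (f n i) => //; apply/mapP; exists i.
Qed.

(** Iterating the step over all requirements, each value is settled at some stage
or stays equal to 1 for ever.  Requirements which do not satisfy the conditions
are skipped. *)
Lemma generic_extension (J : nat -> seq nat) (f : nat -> nat -> nat -> seq B)
    (A : nat -> set nat) (p : nat -> nat -> bool) s :
  good_state s -> exists phi : B -> bool,
  [/\ {in s.1, phi =1 s.2}, (forall b, blk b != [::] -> has phi (blk b)) &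
  forall q, uniq (J q) -> size (J q) <= k -> escaping_family (J q) (f q) ->
    infinite_set (A q) ->
    exists2 n, A q n & {in J q, forall i, parity phi (f q n i) = p q i}].
Proof.
move=> s_ok.
pose valid q := [/\ uniq (J q), size (J q) <= k, escaping_family (J q) (f q)
  & infinite_set (A q)].
have next qs : exists t, good_state qs.2 ->
  [/\ good_state t, state_extends qs.2 t & valid qs.1 -> exists n, [/\ A qs.1 n,
    {in J qs.1, forall i, {subset f qs.1 n i <= t.1}} &
    {in J qs.1, forall i, parity t.2 (f qs.1 n i) = p qs.1 i}]].
  have [ok|nok] := pselect (good_state qs.2); last by exists s.
  have [[uJ sJ fJ iA]|nv] := pselect (valid qs.1).
    by have [t [t1 t2 t3]] := generic_extension_step (p qs.1) uJ sJ fJ iA ok; exists t.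
  by exists qs.2 => _; split=> //; split.
have [nxt nxtP] := choice next.
pose st := fix st j := if j is j'.+1 then nxt (j', st j') else s.
have st_ok j : good_state (st j) by elim: j => //= j /(nxtP (j, st j))[].
have st_ext i j : i <= j -> state_extends (st i) (st j).
  elim: j => [|j IH]; first by rewrite leqn0 => /eqP ->; split.
  rewrite leq_eqVlt => /predU1P[->|]; first by split.
  rewrite ltnS => /IH [e1 e2]; have [_ [e3 e4] _] := nxtP (j, st j) (st_ok j).
  by split=> [b /e1 /e3//|b bs]; rewrite -e2//; apply/e4/e1.
(* A value settled as 1 was 1 before being settled, so the limit functional is
   the conjunction of all stages. *)
pose phi b := `[< forall j, (st j).2 b >].
have phiE j : {in (st j).1, phi =1 (st j).2}.
  move=> b bj; apply/asboolP/idP => [//|tb i].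
  have [ij|/ltnW ji] := leqP i j; last by rewrite (st_ext j i ji).2.
  have [bi|bi] := boolP (b \in (st i).1); last by have [_ ->] := st_ok i.
  by rewrite -(st_ext i j ij).2.
exists phi; split; first exact: (phiE 0).
  move=> b b0.
  have [[j /hasP[c cb cj]]|no] := pselect (exists j, has (fun c => c \in (st j).1) (blk b)).
    have [cl _ /(_ _ b0)/hasP[d db dj]] := st_ok j.
    apply/hasP; exists d => //; rewrite (phiE j)//.
    by apply: (cl _ cj); rewrite (blk_eq cb).
  apply/hasP; exists b; first exact: blk_refl.
  apply/asboolP => j; have [_ -> //] := st_ok j.
  apply/negP => bj; apply: no; exists j; apply/hasP; exists b => //; exact: blk_refl.
move=> q uJ sJ fJ iA; have [_ _ []//] := nxtP (q, st q) (st_ok q).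
move=> n [An sub eq]; exists n => // i iJ; rewrite -eq//.
by apply: eq_parity_in => b /(sub _ iJ) bq; exact: (phiE q.+1).
Qed.

End Core.

(** * Change of basis *)

Definition lin (A B : Type) (f : A -> seq B) (s : seq A) := flatten [seq f a | a <- s].

Lemma lin_cat (A B : Type) (f : A -> seq B) s t : lin f (s ++ t) = lin f s ++ lin f t.
Proof. by rewrite /lin map_cat flatten_cat. Qed.

Lemma lin1 (A B : Type) (f : A -> seq B) a : lin f [:: a] = f a.
Proof. by rewrite /lin /= cats0. Qed.

Lemma parity_lin (A B : eqType) (f : A -> seq B) phi s :
  parity phi (lin f s) = parity (fun a => parity phi (f a)) s.
Proof. by elim: s => // a s IH; rewrite /lin /= parity_cat IH parity_cons. Qed.

(** No nonempty sum of distinct [g l] is a sum of elements of [H]. *)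
Definition independent_mod (T : eqType) (g : nat -> seq T) (H : seq (seq T)) :=
  forall t c, {subset c <= H} -> same_vec (lin g t ++ flatten c) [::] ->
  same_vec t [::].

(** A linear map from the subspace spanned by the [g l] and [H] to the space of
finite subsets of nat extends to the whole space.  By Zorn's lemma there is a
maximal graph [G] of a partial linear map; a graph which is not total can be
enlarged by sending a missing vector to 0. *)
Lemma dual_coordinates (T : eqType) (g : nat -> seq T) (H : seq (seq T)) :
  independent_mod g H -> exists rho : T -> seq nat,
  (forall l, same_vec (lin rho (g l)) [:: l]) /\
  {in H, forall h, same_vec (lin rho h) [::]}.
Proof.
move=> ind.
(* the graph on the span of the [g l] and [H] *)
pose G0 : set (seq T * seq nat) := [set st | exists2 c, {subset c <= H} &
  same_vec st.1 (lin g st.2 ++ flatten c)].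
pose P (G : set (seq T * seq nat)) := [/\ (G !=set0 -> G0 `<=` G),
  (forall s t s' t', G (s, t) -> G (s', t') -> G (s ++ s', t ++ t')),
  (forall s s' t, same_vec s s' -> G (s, t) -> G (s', t)) &
  (forall s t, G (s, t) -> same_vec s [::] -> same_vec t [::])].
have PG0 : P G0.
  split.
  - by move=> _ x.
  - move=> s t s' t' [c cH e] [c' cH' e']; exists (c ++ c').
      by move=> x; rewrite mem_cat => /orP[/cH|/cH'].
    move=> b; move: (e b) (e' b) => /=.
    rewrite lin_cat flatten_cat !coef_cat => -> ->; exact: addbACA.
  - move=> s s' t ss' [c cH /= e]; by exists c => // b /=; rewrite -ss'.
  - by move=> s t [c cH /= e] s0; apply: (ind _ c cH) => b; rewrite -e.
have [F FP Ftot|G [[G1 G2 G3 G4] Gmax]] := @Zorn_bigcup _ P.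
  split.
  - move=> [x [G FG Gx]] y G0y; exists G => //.
    by have [h _ _ _] := FP _ FG; apply: h => //; exists x.
  - move=> s t s' t' [G FG Gx] [G' FG' Gx'].
    have [GG'|G'G] := Ftot _ _ FG FG'.
      by exists G' => //; have [_ h _ _] := FP _ FG'; apply: h => //; apply: GG'.
    by exists G => //; have [_ h _ _] := FP _ FG; apply: h => //; apply: G'G.
  - move=> s s' t ss' [G FG Gx]; exists G => //.
    by have [_ _ h _] := FP _ FG; apply: h Gx.
  - move=> s t [G FG Gx]; have [_ _ _ h] := FP _ FG; exact: h Gx.
have {}G1 : G0 `<=` G.
  apply: contrapT => nG; apply: (Gmax G0) => //; split=> // x Gx.
  by case: nG; apply: G1; exists x.
have G00 : G ([::], [::]) by apply: G1; exists [::].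
have Gtot s : exists t, G (s, t).
  apply: contrapT => nG.
  pose G' : set (seq T * seq nat) := [set st | G st \/ G (st.1 ++ s, st.2)].
  apply: (Gmax G'); first split.
  - by move=> x Gx; left.
  - move=> /(_ (s, [::])) h; apply: nG; exists [::]; apply: h; right => /=.
    by apply: G3 G00 => b; rewrite coef_cat addbb.
  split.
  - by move=> _ x /G1 Gx; left.
  - move=> s1 t1 s2 t2 [] /= h1 [] /= h2.
    + by left; apply: G2.
    + by right => /=; rewrite -catA; apply: G2.
    + right => /=; apply: G3 (G2 _ _ _ _ h1 h2) => b.
      by rewrite !coef_cat addbAC.
    + left; apply: G3 (G2 _ _ _ _ h1 h2) => b.
      by rewrite !coef_cat addbACA addbb addbF.
  - move=> s1 s2 t e [] /= h; [left|right] => /=; first exact: G3 h.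
    by apply: G3 h => b; rewrite !coef_cat e.
  - move=> s1 t [] /= h; first exact: G4 h.
    move=> s10; case: nG; exists t; apply: G3 h => b.
    by rewrite coef_cat s10.
have [rho rhoP] := choice (fun x => Gtot [:: x]).
have linP s : G (s, lin rho s).
  by elim: s => // x s IH; exact: (G2 [:: x] (rho x) s (lin rho s)).
have Guniq s t t' : G (s, t) -> G (s, t') -> same_vec t t'.
  move=> h1 h2 b; have := G4 _ _ (G2 _ _ _ _ h1 h2) _ b.
  rewrite coef_cat coef_nil => e; apply: addIb (coef b t') _ _ _; rewrite addbb e// => c.
  by rewrite coef_cat addbb.
exists rho; split.
- move=> l; apply: Guniq (linP _) _; apply: G1; exists [::] => //= b.
  by rewrite lin1 cats0.
- move=> h hH; apply: Guniq (linP _) _; apply: G1; exists [:: h] => /=.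
    by move=> x; rewrite inE => /eqP ->.
  by rewrite cats0.
Qed.

(** The hypothesis on [T] expresses injectivity of a linear map between spaces of
finitely supported vectors: the preimage of a finite coordinate subspace lies in
a finite coordinate subspace. *)
Lemma escaping_family_image (A B : eqType) (T : seq A -> seq B) J f :
  (forall s t, T (s ++ t) = T s ++ T t) -> T [::] = [::] ->
  (forall S : seq B, exists S' : seq A, forall s,
     (forall b, coef b (T s) -> b \in S) -> forall a, coef a s -> a \in S') ->
  escaping_family J f -> escaping_family J (fun n i => T (f n i)).
Proof.
move=> Tcat T0 TS fJ lam S hl; have [S' S'P] := TS S.
apply: sub_finite_set (fJ lam S' hl) => n /= h; apply: S'P.
suff -> : T (comb lam J (f n)) = comb lam J (fun i => T (f n i)) by [].
rewrite /comb; elim: [seq _ <- _ | _] => //= i J' <-; exact: Tcat.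
Qed.

Section AvoidBlocks.
Variables (T : eqType) (k : nat) (g : nat -> seq T) (H : seq (seq T)).

Let blk (b : nat + T) : seq (nat + T) :=
  if b is inl l then [seq inl (l %/ k.+1 * k.+1 + i) | i <- iota 0 k.+1] else [::].

Let blk_in l m : (inl m \in blk (inl l)) = (m %/ k.+1 == l %/ k.+1).
Proof.
apply/mapP/eqP => [[i]|e].
  rewrite mem_iota add0n => /andP[_ ik] [->].
  by rewrite divnMDl// (divn_small ik) addn0.
exists (m %% k.+1); first by rewrite mem_iota add0n leq0n ltn_mod.
by rewrite -e -divn_eq.
Qed.

Let blk_inr l x : (inr x \in blk (inl l)) = false.
Proof. by apply/negP => /mapP[]. Qed.

(** Each vector v equals the sum of its components along the [g l], given by the
map rho of [dual_coordinates], and of a remainder.  The map [tau] records both,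
respectively over the left and the right summand of [nat + T]; it sends [g l] to
the basis vector [inl l] and [H] into the right summand.  It is injective, so
escaping families stay escaping, and the functional is built after applying
[tau]. *)
Lemma generic_functional (J : nat -> seq nat) (f : nat -> nat -> nat -> seq T)
    (A : nat -> set nat) (p : nat -> nat -> bool) :
  independent_mod g H -> exists phi : T -> bool,
  [/\ {in H, forall h, parity phi h = false},
    (forall n, exists2 i, i < k.+1 & parity phi (g (n * k.+1 + i))) &
  forall q, uniq (J q) -> size (J q) <= k -> escaping_family (J q) (f q) ->
    infinite_set (A q) ->
    exists2 n, A q n & {in J q, forall i, parity phi (f q n i) = p q i}].
Proof.
move=> /dual_coordinates[rho [rhog rhoH]].
pose tau x : seq (nat + T) := map inl (rho x) ++ inr x :: map inr (lin g (rho x)).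
have tauE phi x : parity phi (tau x) =
    parity (phi \o inl) (rho x) (+) parity (phi \o inr) (x :: lin g (rho x)).
  by rewrite parity_cat -map_cons /parity !count_map.
have linE phi s : parity phi (lin tau s) =
    parity (phi \o inl) (lin rho s) (+) parity (phi \o inr) (s ++ lin g (lin rho s)).
  elim: s => // x s IH; rewrite {1}/lin /= parity_cat IH tauE.
  rewrite /lin /= -!/(lin _ _) lin_cat !(parity_cat, parity_cons).
  rewrite addbACA; congr addb; rewrite -!addbA; congr addb.
  by rewrite addbCA.
(* settling the supports of the elements of [H] with the value 0 *)
pose S0 : seq (nat + T) := map inr (flatten H).
pose phi0 (b : nat + T) := b \notin S0.
have phi0l l : phi0 (inl l) by apply/negP => /mapP[].
have [| | | | |phi [phiS phiblk phiq]] := @generic_extension _ k blk _ _ _ _ J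
    (fun q n i => lin tau (f q n i)) A p (S0, phi0).
- case=> [l|x] //= _; by rewrite -/(blk (inl l)) blk_in.
- case=> [l|x] [m|y] //; first by rewrite blk_in /blk => /eqP ->.
  by rewrite blk_inr.
- case=> [l|x] //=; rewrite -[_ && _]/(uniq (map _ (iota 0 k.+1))).
  by rewrite map_inj_uniq ?iota_uniq// => i j [] /addnI.
- by case=> [l|x] //= _; rewrite size_map size_iota.
- split=> /=.
  + by move=> b /mapP[x _ ->].
  + by move=> b; rewrite /phi0 => ->.
  + by case=> [l|x] // _; apply/hasP; exists (inl l); rewrite ?blk_in.
exists (fun x => parity phi (tau x)); split.
- move=> h hH; rewrite -parity_lin linE (same_vec_parity _ (rhoH h hH)).
  rewrite parity_cat [parity _ (lin g _)]parity_lin (same_vec_parity _ (rhoH h hH)).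
  rewrite addbF /= (@eq_parity_in _ _ (fun=> false)) ?parity0// => x xh /=.
  have xS : inr x \in S0 by apply/map_f/flattenP; exists h.
  by rewrite phiS//= /phi0 xS.
- move=> n; have /hasP[[l|x]] := phiblk (inl (n * k.+1)) isT; last by rewrite blk_inr.
  rewrite blk_in mulnK// => /eqP ln phil; exists (l %% k.+1); first by rewrite ltn_mod.
  rewrite -ln -divn_eq -parity_lin linE (same_vec_parity _ (rhog l)) parity_cat.
  rewrite [parity _ (lin g _)]parity_lin (same_vec_parity _ (rhog l)).
  by rewrite !parity_cons /parity /= !addbF addbb addbF.
- move=> q uJ sJ fJ iA; have [//|//||//|n An nq] := phiq q.
    apply: escaping_family_image fJ => [s t||S]; [exact: lin_cat|by []|].
    (* A vector whose image is supported in [S] has components along [g l] for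
       [l] in [SL] only, and a remainder supported in [SR]. *)
    pose SL := pmap (fun b : nat + T => if b is inl l then Some l else None) S.
    pose SR := pmap (fun b : nat + T => if b is inr l then Some l else None) S.
    exists (SR ++ lin g SL) => s h a as_.
    have hl l : coef l (lin rho s) -> l \in SL.
      have := h (inl l); rewrite /coef linE.
      rewrite [X in _ (+) X](@eq_parity_in _ _ (fun=> false))// parity0 addbF.
      by move=> h' /h' lS; rewrite mem_pmap; apply/mapP; exists (inl l).
    rewrite mem_cat orbC; have [//|aL] := boolP (a \in lin g SL).
    have ca : coef a (lin g (lin rho s)) = false.
      rewrite /coef parity_lin; apply: parity_coef0 => l /hl lS.
      apply/negP => /coef_in al; move/negP: aL; apply.
      by apply/flattenP; exists (g l) => //; apply/mapP; exists l.
    have := h (inr a); rewrite /coef linE.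
    rewrite [X in X (+) _](@eq_parity_in _ _ (fun=> false))// parity0 addFb.
    rewrite -[parity _ (s ++ _)]/(coef a (s ++ _)) coef_cat ca as_ => /(_ isT) aS.
    by rewrite mem_pmap; apply/mapP; exists (inr a).
  by exists n => // i iJ; rewrite -parity_lin nq.
Qed.

End AvoidBlocks.

(** * The choice of the rows *)

(** A single nonzero vector can be given the value 1 by an initial state which
settles its support; here there are no blocks. *)
Lemma separating_functional (T : eqType) k (v : seq T) c
    (J : nat -> seq nat) (f : nat -> nat -> nat -> seq T)
    (A : nat -> set nat) (p : nat -> nat -> bool) :
  coef c v -> exists phi : T -> bool, parity phi v /\
  forall q, uniq (J q) -> size (J q) <= k -> escaping_family (J q) (f q) ->
    infinite_set (A q) ->
    exists2 n, A q n & {in J q, forall i, parity phi (f q n i) = p q i}.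
Proof.
move=> cv; pose phi0 b := (b == c) || (b \notin v).
have [//|//|//|//||phi [phiv _ phiq]] :=
    @generic_extension T k (fun=> [::]) _ _ _ _ J f A p (v, phi0).
  by split=> //= b; rewrite /phi0 => ->; rewrite orbT.
exists phi; split=> //; rewrite (eq_parity_in phiv) (_ : parity _ _ = coef c v)//.
by apply: eq_parity_in => b; rewrite /phi0 /= => ->; rewrite orbF.
Qed.

(** Recursion along a well-founded relation for objects which are only known to
exist: the value at [a] is chosen from the values below [a]. *)
Lemma wf_choice (T V : Type) (lt : T -> T -> Prop) (v0 : V)
    (R : T -> (T -> V) -> V -> Prop) :
  well_founded lt ->
  (forall a Phi, exists v, R a Phi v) ->
  (forall a Phi Phi' v, (forall b, lt b a -> Phi b = Phi' b) ->
     R a Phi v -> R a Phi' v) ->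
  exists Phi : T -> V, forall a, R a Phi (Phi a).
Proof.
move=> wf ex loc.
have [nxt nxtP] := choice (fun x : T * (T -> V) => ex x.1 x.2).
pose ext a (rec : forall b, lt b a -> V) b :=
  if pselect (lt b a) is left h then rec b h else v0.
pose F a (rec : forall b, lt b a -> V) := nxt (a, ext a rec).
pose Phi := Fix wf (fun=> V) F.
have PhiE a : Phi a = nxt (a, ext a (fun b _ => Phi b)).
  rewrite /Phi Fix_eq// => x r r' rr'; congr F.
  by apply: functional_extensionality_dep => b; apply: functional_extensionality_dep.
exists Phi => a; rewrite [in X in R _ _ X]PhiE.
have /= := nxtP (a, ext a (fun b _ => Phi b)); apply: loc => b ba.
by rewrite /ext; case: pselect.
Qed.

Section Construction.
Variables (T : eqType) (lt : rel T) (k : nat) (e : T -> nat -> nat -> seq T).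
Hypothesis lt_wf : well_founded lt.

Hypothesis lt_countable : forall a, exists s : nat -> T, forall b, lt b a -> exists n, s n = b.

Definition below a (s : seq T) := all (fun b => lt b a) s.

(** The indices at which the earlier rows listed in [F] take prescribed values on
the family; a subset of [J] is coded by a list. *)
Definition follows (Phi : T -> T -> bool) (f : nat -> nat -> seq T) (J : seq nat)
    (F : seq (T * seq nat)) : set nat :=
  [set n | {in F, forall x, {in J, forall i, parity (Phi x.1) (f n i) = (i \in x.2)}}].

(** The bound [M] turns the existence of one index into that of infinitely
many. *)
Definition generic_at a Phi phi (f : nat -> nat -> seq T) :=
  forall J F p M, uniq J -> size J <= k -> escaping_family J f ->
    (forall n i, i \in J -> below a (f n i)) -> below a (map fst F) ->
    infinite_set (follows Phi f J F) ->
  exists n, [/\ M <= n, follows Phi f J F n &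
    {in J, forall i, parity phi (f n i) = (i \in (p : seq nat))}].

(** A code [y] carries a sequence [y 0] and, in the first [k.+1] entries of [y 1],
the vectors modulo which that sequence is to be independent. *)
Definition targets (y : nat -> nat -> seq T) := [seq y 1 i | i <- iota 0 k.+1].

Definition avoids phi (y : nat -> nat -> seq T) :=
  {in targets y, forall h, parity phi h = false} /\
  forall n, exists2 i, i < k.+1 & parity phi (y 0 (n * k.+1 + i)).

(** The four clauses serve property (P), the failure of selective
pseudocompactness, the independence of the generators and the genericity of row
[a].  The code [e x] of index [x] is read in a different way by each of them; in
the first clause it lists, as singletons, the coordinates at which generator [x]
should be 1. *)
Definition stage a Phi phi :=
  [/\ forall x, ~~ lt x a -> phi x = `[< exists n, e x 0 n = [:: a] >],
      (forall l, below a (e a 0 l)) -> {in targets (e a), forall h, below a h} ->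
        independent_mod (e a 0) (targets (e a)) -> avoids phi (e a),
      e a 0 0 = [::] -> below a (e a 1 0) -> (exists b, coef b (e a 1 0)) ->
        parity phi (e a 1 0) &
      forall b, lt b a -> generic_at a Phi phi (e b)].

Lemma eq_below_parity a phi psi s : (forall b, lt b a -> phi b = psi b) ->
  below a s -> parity phi s = parity psi s.
Proof. by move=> h /allP sa; apply: eq_parity_in => b /sa /h. Qed.

(** Only countably many requirements concern row [a], because everything they
mention lies below [a].  The avoidance and the separation clauses exclude each
other, a sequence with [e a 0 0] empty being dependent.  The values at indices
not below [a] are changed at the end, which affects no vector supported below
[a]. *)
Lemma stage_exists a Phi : exists phi, stage a Phi phi.
Proof.
have [s sP] := lt_countable a.
pose R := (nat * seq nat * seq (nat * seq nat) * seq nat * nat)%type.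
pose dec q : R := odflt (0, [::], [::], [::], 0) (unpickle q).
pose fq q := e (s (dec q).1.1.1.1).
pose Jq q := (dec q).1.1.1.2.
pose Fq q : seq (T * seq nat) := [seq (s x.1, x.2) | x <- (dec q).1.1.2].
pose pq q i := i \in (dec q).1.2.
pose Aq q : set nat := follows Phi (fq q) (Jq q) (Fq q) `\` [set n | n < (dec q).2].
pose good phi := forall q, uniq (Jq q) -> size (Jq q) <= k ->
  escaping_family (Jq q) (fq q) -> infinite_set (Aq q) ->
  exists2 n, Aq q n & {in Jq q, forall i, parity phi (fq q n i) = pq q i}.
have [phi [phi2 phi3 phigood]] : exists phi, [/\
    independent_mod (e a 0) (targets (e a)) -> avoids phi (e a),
    e a 0 0 = [::] -> (exists b, coef b (e a 1 0)) -> parity phi (e a 1 0) &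
    good phi].
  have [ind|nind] := pselect (independent_mod (e a 0) (targets (e a))).
    have [phi [h1 h2 h3]] := @generic_functional _ k _ _ Jq fq Aq pq ind.
    exists phi; split=> // e0.
    have h : same_vec [:: 0] [::] by apply: (ind _ [::]) => //; rewrite lin1 e0.
    by have := h 0.
  have [[b bv]|nv] := pselect (exists b, coef b (e a 1 0)).
    by have [phi [h1 h2]] := separating_functional k Jq fq Aq pq bv; exists phi.
  have [//|//|//|//||phi [_ _ h]] :=
      @generic_extension T k (fun=> [::]) _ _ _ _ Jq fq Aq pq ([::], fun=> true).
    by [].
  by exists phi.
pose psi x := if lt x a then phi x else `[< exists n, e x 0 n = [:: a] >].
have psiE u : below a u -> parity psi u = parity phi u.
  by apply: eq_below_parity => b ba; rewrite /psi ba.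
exists psi; split.
- by move=> x /negPf xa; rewrite /psi xa.
- move=> h1 h2 /phi2[h3 h4]; split=> [h hH|n]; first by rewrite psiE ?h3// h2.
  by have [i ik pi] := h4 n; exists i; rewrite ?psiE.
- by move=> e0 va vb; rewrite psiE// phi3.
- move=> b /sP[nb <-] J F p M uJ szJ fJ fa Fa infA.
  have [Fn FnE] : exists Fn : seq (nat * seq nat), F = [seq (s x.1, x.2) | x <- Fn].
    elim: F Fa {infA} => [|[c w] F IH] /=; first by exists [::].
    by move=> /andP[/sP[m <-] /IH[Fn ->]]; exists ((m, w) :: Fn).
  have := phigood (pickle (nb, J, Fn, p, M)).
  rewrite /Aq /pq /Fq /Jq /fq /dec pickleK /= -FnE.
  case=> // [|n [An /negP nM] nJ].
    by apply: infinite_setD => //; exact: finite_II.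
  exists n; split=> // [|i iJ]; first by rewrite leqNgt.
  by rewrite psiE ?nJ// fa.
Qed.

Lemma rows_exist : exists Phi : T -> T -> bool, forall a, stage a Phi (Phi a).
Proof.
apply: (@wf_choice _ _ lt (fun=> false)) => //; first exact: stage_exists.
move=> a Phi Phi' phi E [h1 h2 h3 h4]; split=> // b ba J F p M uJ szJ fJ fa Fa.
have -> : follows Phi' (e b) J F = follows Phi (e b) J F.
  apply/seteqP; split=> n h x xF i iJ; rewrite -(h x xF i iJ) E//;
  by apply: (allP Fa); apply: map_f.
exact: h4.
Qed.

End Construction.

(** * Consequences of genericity *)

Lemma infinite_nat_unbounded (A : set nat) :
  (forall M, exists2 n, M <= n & A n) -> infinite_set A.
Proof.
move=> h /finite_fsetP[X AX].
have [n Mn] := h (\max_(i <- finmap.enum_fset X) i).+1; rewrite AX /= => nX.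
by have := @leq_bigmax_seq _ (finmap.enum_fset X) predT id n nX isT; rewrite leqNgt Mn.
Qed.

Lemma card_le_injection (U T : Type) (A : set T) :
  [set: U] #<= A -> exists2 s : U -> T, injective s & forall u, A (s u).
Proof.
move=> /card_leP[s].
exists (fun u => \val (s (exist _ u (mem_set I)))) => [u v /val_inj|u]; last exact: set_valP.
by move=> /(inj (mem_set I) (mem_set I)) [].
Qed.

Lemma infinite_injection (T : Type) (A : set T) :
  infinite_set A -> exists2 s : nat -> T, injective s & forall n, A (s n).
Proof. by move=> /infiniteP; exact: card_le_injection. Qed.

Lemma injective_image_infinite (s : nat -> nat) (A B : set nat) :
  injective s -> infinite_set A -> (forall n, A n -> B (s n)) -> infinite_set B.
Proof.
move=> sinj Ainf AB; apply: (@sub_infinite_set _ (s @` A)).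
  by move=> _ [n An <-]; exact: AB.
by rewrite (eq_finite_set (inj_card_eq _))//; exact: in2W.
Qed.

(** There are finitely many vectors supported in [S]. *)
Lemma finite_support_pigeonhole (T : eqType) (S : seq T) (v : nat -> seq T)
    (A : set nat) : infinite_set A ->
  (forall n, A n -> forall b, coef b (v n) -> b \in S) ->
  exists (c : seq T) (A' : set nat), [/\ A' `<=` A, infinite_set A' &
    forall n, A' n -> same_vec (v n) c].
Proof.
move=> Ainf vS.
have [A' [A'A A'inf [d dP]]] : exists A', [/\ A' `<=` A, infinite_set A' &
    exists d : T -> bool, forall n, A' n -> {in S, forall b, coef b (v n) = d b}].
  elim: S {vS} => [|b S [A' [A'A A'inf [d dP]]]].
    by exists A; split => //; exists (fun=> true).
  pose C x := A' `&` [set n | coef b (v n) = x].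
  have [x Cx] : exists x, infinite_set (C x).
    apply: contrapT => /forallNP fin; apply: A'inf.
    have -> : A' = C true `|` C false.
      apply/seteqP; split=> [n An|n [[]|[]]//].
      by case E : (coef b (v n)); [left|right].
    by rewrite finite_setU; split; apply: contrapT; exact: fin.
  exists (C x); split=> //; first by move=> n [/A'A].
  exists (fun c => if c == b then x else d c) => n [An bx] c.
  by rewrite inE; case: eqVneq => [->|_] //= /(dP _ An).
exists [seq b <- undup S | d b], A'; split=> // n An b.
rewrite {2}/coef /parity count_uniq_mem ?filter_uniq ?undup_uniq// oddb.
rewrite mem_filter mem_undup andbC.
have [/(dP _ An) //|bS] := boolP (b \in S).
by apply/negP => /(vS _ (A'A _ An)); rewrite (negPf bS).
Qed.

Section Consequences.
Variables (T : eqType) (lt : rel T) (k : nat) (e : T -> nat -> nat -> seq T) (x0 : T).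
Hypothesis lt_wf : well_founded lt.
Hypothesis lt_irr : irreflexive lt.
Hypothesis lt_trans : transitive lt.
Hypothesis lt_total : forall a b, [|| lt a b, a == b | lt b a].
Hypothesis lt_countable : forall a, exists s : nat -> T, forall b, lt b a -> exists n, s n = b.
Hypothesis lt_bounded : forall s : nat -> T, exists b, forall n, lt (s n) b.
Hypothesis e_cofinal : forall y b, exists2 a, lt b a & e a = y.
Variable Phi : T -> T -> bool.
Hypothesis PhiP : forall a, stage lt k e a Phi (Phi a).

Lemma lt_asym a b : lt a b -> lt b a = false.
Proof. by move=> ab; apply/negP => /(lt_trans ab); rewrite lt_irr. Qed.

Lemma below_trans a b s : lt a b -> below lt a s -> below lt b s.
Proof. by move=> ab /allP sa; apply/allP => x /sa xa; exact: lt_trans xa ab. Qed.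

Lemma below_bounded (s : nat -> nat -> seq T) : exists b, forall m n, below lt b (s m n).
Proof.
(* one sequence running through all entries of all lists *)
pose t q := if unpickle q is Some (m, n, i) then nth x0 (s m n) i else x0.
have [b tb] := lt_bounded t; exists b => m n; apply/(all_nthP x0) => i _.
by have := tb (pickle (m, n, i)); rewrite /t pickleK.
Qed.

(** The code of a generator far above the given coordinates lists those where [q]
is true. *)
Lemma prescribe_coordinates (a : nat -> T) (q : T -> bool) :
  exists x, forall n, Phi (a n) x = q (a n).
Proof.
pose y (j n : nat) := if q (a n) then [:: a n] else [::].
have [b ab] := lt_bounded a; have [x bx ex] := e_cofinal y b.
exists x => n; have [PhiE _ _ _] := PhiP (a n).
rewrite PhiE ?(lt_asym (lt_trans (ab n) bx))// ex /y.
apply/asboolP/idP => [[m]|qn]; last by exists n; rewrite qn.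
by case: ifP => // qm [<-].
Qed.

Lemma separate_vector v : (exists b, coef b v) -> exists a, parity (Phi a) v.
Proof.
move=> hv; pose y (j n : nat) := if j is 0 then [::] else v.
have [b yb] := below_bounded y; have [a ba ea] := e_cofinal y b.
exists a; have [_ _ + _] := PhiP a; rewrite ea; apply=> //.
exact: below_trans ba (yb 1 0).
Qed.

Lemma avoid_exists y : independent_mod (y 0) (targets k y) ->
  exists a, avoids k (Phi a) y.
Proof.
move=> ind; have [b yb] := below_bounded y; have [a ba ea] := e_cofinal y b.
exists a; have [_ + _ _] := PhiP a; rewrite ea; apply=> //.
  by move=> l; exact: below_trans ba (yb 0 l).
by move=> h /mapP[i _ ->]; exact: below_trans ba (yb 1 i).
Qed.

(** Row [a] is generic for [f] as soon as [a] exceeds an index coding [f] and all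
indices occurring in [f]. *)
Lemma generic_above (f : nat -> nat -> seq T) J :
  uniq J -> size J <= k -> escaping_family J f ->
  exists b, forall a, ~~ lt a b -> forall F p, below lt a (map fst F) ->
    infinite_set (follows Phi f J F) -> infinite_set (follows Phi f J ((a, p) :: F)).
Proof.
move=> uJ sJ fJ; have [c fc] := below_bounded f; have [b cb eb] := e_cofinal f c.
have [b' b'P] := lt_bounded (fun=> b).
exists b' => a ab F p Fa Finf; apply: infinite_nat_unbounded => M.
have b'a x : lt x b' -> lt x a.
  move=> xb; have /or3P[b'a|/eqP <-//|h] := lt_total b' a; first exact: lt_trans b'a.
  by rewrite h in ab.
have [_ _ _ /(_ _ (b'a _ (b'P 0)))] := PhiP a; rewrite eb.
move=> /(_ J F p M uJ sJ fJ) [|//|//|n [Mn Fn nJ]].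
  move=> n i _; apply: below_trans (fc n i).
  by apply: lt_trans cb _; exact: (b'a _ (b'P 0)).
by exists n => // x; rewrite inE => /predU1P[->|/Fn].
Qed.

Lemma list_max (s : seq T) : s != [::] ->
  exists2 m, m \in s & {in s, forall a, a != m -> lt a m}.
Proof.
elim: s => // a [|c s] IH _.
  by exists a; rewrite ?inE// => x; rewrite inE => ->.
have [m ms mmax] := IH isT.
have [ma|am] := boolP (lt m a).
  exists a; rewrite ?mem_head// => x; rewrite inE => /predU1P[->|xs]; first by rewrite eqxx.
  by move=> _; have [->//|/(mmax _ xs) xm] := eqVneq x m; exact: lt_trans xm ma.
exists m; first by rewrite inE ms orbT.
move=> x; rewrite inE => /predU1P[->|]; last exact: mmax.
by have := lt_total a m; rewrite (negPf am) => /or3P[//|->|].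
Qed.

(** Starting with the coordinates below [b], the remaining ones are added in
increasing order; genericity of each new row keeps the set of indices infinite.
The induction is on an upper bound of [F], removing its largest element. *)
Lemma follow_all (f : nat -> nat -> seq T) J (w : T -> seq nat) b (D : set T) :
  (forall a, ~~ lt a b -> forall F p, below lt a (map fst F) ->
    infinite_set (follows Phi f J F) -> infinite_set (follows Phi f J ((a, p) :: F))) ->
  (forall F : seq T, below lt b F -> {in F, forall a, D a} ->
    infinite_set (follows Phi f J [seq (a, w a) | a <- F])) ->
  forall F : seq T, {in F, forall a, D a} ->
    infinite_set (follows Phi f J [seq (a, w a) | a <- F]).
Proof.
move=> gen base F FD.
have [m Fm] : exists m, below lt m F.
  by have [m mP] := below_bounded (fun _ _ => F); exists m; exact: (mP 0 0).
elim/(well_founded_ind lt_wf): m F FD Fm => m IH F FD Fm.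
have [->|F0] := eqVneq F [::]; first exact: (base [::]).
have [c cF cmax] := list_max F0.
have [cb|cb] := boolP (lt c b).
  apply: base => //; apply/allP => a aF.
  by have [->//|/(cmax _ aF) ac] := eqVneq a c; exact: lt_trans ac cb.
(* [c] is the largest element of [F] and lies at or above [b] *)
pose F' := [seq a <- F | a != c].
have F'c : below lt c F'.
  by apply/allP => a; rewrite mem_filter => /andP[ac aF]; exact: cmax.
have /(gen c cb _ (w c)) : infinite_set (follows Phi f J [seq (a, w a) | a <- F']).
  apply: (IH c) => //; first exact: (allP Fm).
  by move=> a; rewrite mem_filter => /andP[_ /FD].
rewrite -map_comp map_id => /(_ F'c); apply: sub_infinite_set => n h _ /mapP[a aF ->].
have [ac|ac] := eqVneq a c; first by apply: h; rewrite ac mem_head.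
by apply: h; rewrite inE map_f ?orbT// mem_filter ac.
Qed.

(** A sequence of distinct vectors is an escaping family with one member, and no
condition is imposed below [b]. *)
Lemma hfd_sequence (z : nat -> seq T) : 0 < k ->
  (forall m n, same_vec (z m) (z n) -> m = n) ->
  exists b, forall (F : seq T) (w : T -> bool), {in F, forall a, ~~ lt a b} ->
    exists n, {in F, forall a, parity (Phi a) (z n) = w a}.
Proof.
move=> k0 zinj; pose f (n i : nat) := z n.
have fJ : escaping_family [:: 0] f.
  move=> lam S; rewrite has_seq1 => l0; apply: contrapT => inf.
  have [|c [A' [_ A'inf A'c]]] := @finite_support_pigeonhole _ S z _ inf.
    by move=> n; rewrite /= /comb /= l0 /= cats0.
  apply: A'inf; have [[n An]|no] := pselect (A' !=set0).
    apply: (sub_finite_set _ (finite_set1 n)) => m Am.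
    by apply: zinj => b; rewrite (A'c _ Am) (A'c _ An).
  by apply: (sub_finite_set _ (finite_set0 nat)) => m Am; apply: no; exists m.
have [//|//|b gen] := generic_above _ _ fJ.
exists b => F w Fb.
pose v a := if w a then [:: 0] else [::].
have [|n nF] := infinite_setN0 (@follow_all f [:: 0] v b (fun a => ~~ lt a b) gen _ F Fb).
  move=> G Gb GD; have -> : G = [::].
    case: G Gb GD => // c G /andP[cb _] /(_ c (mem_head _ _)); by rewrite cb.
  by apply: infinite_nat_unbounded => M; exists M.
exists n => a aF; have := nF (a, v a) (map_f _ aF) 0 (mem_head _ _).
by move=> /= ->; rewrite /v; case: (w a).
Qed.

(** Below [b] the coordinates of the accumulation point are the limits along a free
ultrafilter; by [prescribe_coordinates] some generators [x i] have these
coordinates.  Above [b] whatever coordinates they have is a limit value by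
genericity. *)
Lemma accumulation_escaping (f : nat -> nat -> seq T) J :
  uniq J -> size J <= k -> escaping_family J f ->
  exists w : nat -> seq T, forall F : seq T, infinite_set
   [set n | {in F, forall a, {in J, forall i, parity (Phi a) (f n i) = parity (Phi a) (w i)}}].
Proof.
move=> uJ sJ fJ; have [b gen] := generic_above uJ sJ fJ.
have [U [UU Uoo]] := ultraFilterLemma (eventually_filter : ProperFilter \oo).
(* the limit along the ultrafilter of coordinate [a] of member [i] *)
pose q a i := `[< U [set n | parity (Phi a) (f n i)] >].
have qU a i : U [set n | parity (Phi a) (f n i) = q a i].
  rewrite /q; case: asboolP => // nU.
  have [//|] := in_ultra_setVsetC [set n | parity (Phi a) (f n i)] UU.
  by apply: filterS => n /negP /negPf.
have [s sP] := lt_countable b.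
have /choice[x xP] i : exists x, forall n, Phi (s n) x = q (s n) i.
  by have [x xP] := prescribe_coordinates s (fun a => q a i); exists x.
pose w a := [seq i <- J | Phi a (x i)].
exists (fun i => [:: x i]) => F.
have := @follow_all f J w b setT gen _ F (fun a _ => I).
move=> h; apply: sub_infinite_set (h _) => [n nF a aF i iJ|].
  have := nF (a, w a) (map_f _ aF) i iJ => /= ->.
  by rewrite mem_filter iJ andbT /parity /= addn0 oddb.
move=> G Gb _.
have UG : U (follows Phi f J [seq (a, w a) | a <- G]).
  elim: G Gb => [|a G IH] /=; first by move=> _; apply: filterS filterT => n _ z.
  move=> /andP[/sP[m ma] /IH UG].
  have UJ : U [set n | {in J, forall i, parity (Phi a) (f n i) = q a i}].
    elim: (J) => [|i J' IHJ]; first by apply: filterS filterT => n _ i.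
    apply: filterS (filterI (qU a i) IHJ) => n [h1 h2] j.
    by rewrite inE => /predU1P[->//|/h2].
  apply: filterS (filterI UJ UG) => n [h1 h2] z.
  rewrite inE => /predU1P[->|/h2//] i iJ /=.
  by rewrite h1// mem_filter iJ andbT -ma xP.
apply: infinite_nat_unbounded => M.
have UM : U [set n | M <= n] by apply: Uoo; exists M.
by have [n [Mn nG]] := filter_ex (filterI UM UG); exists n.
Qed.

(** If the family is not escaping, some combination involving a member [i0] is
constant along an infinite set of indices.  There the member [i0] is determined
by the others, which are treated by induction. *)
Lemma accumulation_exists J : uniq J -> size J <= k -> forall f : nat -> nat -> seq T,
  exists w : nat -> seq T, forall F : seq T, infinite_set
   [set n | {in F, forall a, {in J, forall i, parity (Phi a) (f n i) = parity (Phi a) (w i)}}].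
Proof.
have [m] := ubnP (size J); elim: m J => // m IH J; rewrite ltnS => Jm uJ sJ f.
have [fJ|] := pselect (escaping_family J f); first exact: accumulation_escaping.
move=> /existsNP[lam] /existsNP[S] /not_implyP[hlam inf].
have [|c [A' [_ A'inf A'c]]] :=
  @finite_support_pigeonhole _ S (fun n => comb lam J (f n)) _ inf; first by [].
have /hasP[i0 i0J li0] := hlam.
have [s sinj sA] := infinite_injection A'inf.
have pJ := perm_to_rem i0J.
have [||| w wP] := IH (rem i0 J) _ _ _ (fun n => f (s n)).
- by move: Jm; rewrite (perm_size pJ).
- exact: rem_uniq.
- by apply: leq_trans sJ; rewrite (perm_size pJ) /=.
pose w' i := if i == i0 then c ++ comb lam (rem i0 J) w else w i.
exists w' => F; apply: (injective_image_infinite sinj (wP F)) => n /= h a aF i iJ.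
have hrem j : j \in rem i0 J -> parity (Phi a) (f (s n) j) = parity (Phi a) (w j) by exact: h.
rewrite /w'; case: eqP => [->|/eqP ii0]; last first.
  by apply: hrem; rewrite mem_rem_uniq// inE ii0.
rewrite parity_cat -(same_vec_parity _ (A'c _ (sA n))) !parity_comb.
rewrite (permP pJ) /= oddD oddb li0 /=.
rewrite -addbA [X in _ (+) X](_ : _ = false) ?addbF//.
rewrite (@eq_in_count _ _ (fun i => lam i && parity (Phi a) (w i)) (rem i0 J)) ?addbb//.
by move=> j jJ /=; rewrite hrem.
Qed.

End Consequences.

(** * The continuum as an ordinal under the continuum hypothesis *)

Lemma injection_card_le (U T : Type) (A : set U) (s : U -> T) (B : set T) :
  injective s -> (forall u, A u -> B (s u)) -> A #<= B.
Proof.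
move=> sinj AB; have sA : s @` A #= A by apply: inj_card_eq; exact: in2W.
by rewrite -(card_le_eql sA); apply: subset_card_le => _ [u Au <-]; exact: AB.
Qed.

(** Cantor's diagonal argument. *)
Lemma power_set_uncountable : ~ countable [set: set nat].
Proof.
move=> /countable_injP[f finj].
(* the diagonal set, transported along [f] *)
pose X := [set n | exists2 A, n = f A & ~ A n].
have fX : ~ X (f X).
  move=> XX; have [A fA nA] := XX; apply: nA.
  by rewrite -(finj X A)// in_setT.
exact: (fX (ex_intro2 _ _ X erefl fX)).
Qed.

Lemma countable_sequence (T : Type) (x0 : T) (A : set T) :
  countable A -> exists s : nat -> T, forall b, A b -> exists n, s n = b.
Proof.
move=> /countable_injP[h hinj].
exists (fun n => if pselect (exists2 b, A b & h b = n) is left H then projT1 (cid2 H) else x0).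
move=> b Ab; exists (h b); case: pselect => [H|]; last by case; exists b.
by case: (cid2 H) => c /= Ac; apply: hinj; exact: mem_set.
Qed.

(** The classical alias of [I] has a decidable equality, which lists of indices
need. *)
Definition strict (I : Type) (le : rel I) : rel {classic I} :=
  fun a b => (a != b) && le a b.

Section ContinuumOrdinal.
Variables (I : Type) (le : rel I).
Hypothesis CH : continuum_hypothesis.
Hypothesis leI : continuum_ordinal le.
Let T : choiceType := {classic I}.
Let lt : rel T := strict le.

Let le_min (A : set T) : A !=set0 -> exists2 z, A z & forall y, A y -> le z y.
Proof.
move=> [a Aa]; have [wo _ _] := leI; have [|z [[Az zmin] _]] := wo (mem A).
  by exists a; apply/mem_set.
by exists z => [|y Ay]; [exact/set_mem | apply/zmin/mem_set].
Qed.

Let le_total (x y : T) : le x y || le y x.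
Proof.
have [z [->|->] zmin] := le_min (ex_intro [set x; y] x (or_introl erefl)).
  by rewrite (zmin y)//; right.
by rewrite (zmin x) ?orbT//; left.
Qed.

Let le_anti (x y : T) : le x y -> le y x -> x = y.
Proof.
move=> xy yx; have [wo _ _] := leI; have [|z [_ zu]] := wo (mem [set x; y]).
  by exists x; apply/mem_set; left.
have m w : (w = x \/ w = y) -> z = w.
  move=> wE; apply: zu; split; first exact/mem_set.
  have lerefl u : le u u by have := le_total u u; rewrite orbb.
  by move=> u /set_mem[->|->]; case: wE => ->.
by rewrite -(m x) ?(m y)//; [right|left].
Qed.

Lemma ordinal_lt_total (a b : T) : [|| lt a b, a == b | lt b a].
Proof.
rewrite /lt /strict; case: eqVneq => [->|ab] /=; first by [].
exact: le_total.
Qed.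

Lemma ordinal_lt_irr : irreflexive lt.
Proof. by move=> a; rewrite /lt /strict eqxx. Qed.

Lemma ordinal_lt_wf : well_founded lt.
Proof.
move=> a; apply: contrapT => na.
have [z nz zmin] := le_min (ex_intro (fun a => ~ Acc lt a) a na).
apply: nz; constructor => y /andP[yz leyz]; apply: contrapT => /zmin lezy.
by move/eqP: yz; apply; exact: le_anti.
Qed.

Lemma ordinal_lt_trans : transitive lt.
Proof.
move=> y x z xy yz.
have [w [[->|->]|->] wmin] :=
  le_min (ex_intro ([set x; y] `|` [set z]) x (or_introl (or_introl erefl))).
- have xz : le x z by apply: wmin; right.
  rewrite /lt /strict xz andbT; apply: contraTneq xy => ->.
  apply/negP => /andP[_ zy]; move/andP: yz => [/eqP yz lyz].
  by apply: yz; exact: le_anti.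
- have yx : le y x by apply: wmin; left; left.
  by move/andP: xy => [/eqP + lexy]; case; exact: le_anti.
- have zy : le z y by apply: wmin; left; right.
  by move/andP: yz => [/eqP + leyz]; case; exact: le_anti.
Qed.

Let embed : exists g : I -> set nat, injective g.
Proof.
have [_ + _] := leI; rewrite card_eq_le => /andP[/card_le_injection[g ginj _] _].
by exists g.
Qed.

Let unembed : exists g : set nat -> I, injective g.
Proof.
have [_ + _] := leI; rewrite card_eq_le => /andP[_ /card_le_injection[g ginj _]].
by exists g.
Qed.

Lemma ordinal_uncountable : ~ countable [set: T].
Proof.
by have [_ + _] := leI => /eq_countable ->; exact: power_set_uncountable.
Qed.

(** This is where the continuum hypothesis is used. *)
Lemma ordinal_segment_countable (a : T) : countable [set b | lt b a].
Proof.
have [g ginj] := embed; have gS : g @` [set b | lt b a] #= [set b | lt b a].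
  by apply: inj_card_eq; exact: in2W.
rewrite -(eq_countable gS); have [//|big] := CH (g @` [set b | lt b a]).
have [_ _ /(_ a)[]] := leI.
move: big; rewrite (card_eql gS) card_eq_le => /andP[_ H].
apply: card_le_trans H _; apply: subset_card_le => b /andP[/eqP ba leba].
by split.
Qed.

Lemma ordinal_lt_countable (a : T) :
  exists s : nat -> T, forall b, lt b a -> exists n, s n = b.
Proof. exact: countable_sequence (ordinal_segment_countable a). Qed.

Let initial_countable (a : T) : countable [set b | ~~ lt a b].
Proof.
have [s sP] := ordinal_lt_countable a.
apply: (@sub_countable _ _ _
    (\bigcup_(n in [set: nat]) [set if n is m.+1 then s m else a])).
  apply: subset_card_le => b /= ab.
  have /or3P[/sP[n <-]|/eqP ->|h] := ordinal_lt_total b a; last by rewrite h in ab.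
    by exists n.+1.
  by exists 0.
by apply: bigcup_countable => // n _; exact: countable1.
Qed.

Lemma ordinal_lt_bounded (s : nat -> T) : exists b, forall n, lt (s n) b.
Proof.
apply: contrapT => nb; apply: ordinal_uncountable.
apply: (@sub_countable _ _ _ (\bigcup_(n in [set: nat]) [set b | ~~ lt (s n) b])).
  apply: subset_card_le => b _.
  apply: contrapT => h; apply: nb; exists b => n.
  by apply: contrapT => /negP hn; apply: h; exists n.
by apply: bigcup_countable => // n _; exact: initial_countable.
Qed.

Let codeE : exists code : T * (nat -> nat -> seq T) -> set nat, injective code.
Proof.
have [g ginj] := embed.
pose D := (nat + (nat * nat * nat * option nat))%type.
pose bit (cy : T * (nat -> nat -> seq T)) (d : D) : Prop :=
  match d with
  | inl j => g cy.1 j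
  | inr (p, q, r, None) => r < size (cy.2 p q)
  | inr (p, q, r, Some j) => g (nth cy.1 (cy.2 p q) r) j
  end.
pose code cy : set nat := [set m | if unpickle m is Some d then bit cy d else False].
exists code => -[c y] [c' y'] E.
have Ed (d : D) : bit (c, y) d = bit (c', y') d.
  have : code (c, y) (pickle d) = code (c', y') (pickle d) by rewrite E.
  by rewrite /code /mkset pickleK.
have cc : c = c'.
  by apply: ginj; apply/funext => j; exact: (Ed (inl j)).
rewrite -{}cc in Ed *; congr pair; apply/funext => p; apply/funext => q.
have szlt r : (r < size (y p q)) = (r < size (y' p q)).
  have /= h := Ed (inr (p, q, r, None)).
  by apply/idP/idP; rewrite h.
have sz : size (y p q) = size (y' p q).
  apply/eqP; rewrite eqn_leq [X in X && _]leqNgt [X in _ && X]leqNgt.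
  by rewrite szlt ltnn -szlt ltnn.
apply: (@eq_from_nth _ c) => // r _; apply: ginj; apply/funext => j.
exact: (Ed (inr (p, q, r, Some j))).
Qed.

(** By [codeE] pairs of an index and a code embed into I, hence each code has as
many preimages as there are indices, while the indices not above [b] are
countably many. *)
Lemma ordinal_enumeration : exists e : T -> nat -> nat -> seq T,
  forall y b, exists2 a, lt b a & e a = y.
Proof.
have [code codeinj] := codeE; have [g ginj] := unembed.
pose F cy : T := g (code cy).
have Finj : injective F by move=> x y /ginj/codeinj.
pose e (a : T) : nat -> nat -> seq T :=
  if pselect (exists cy, F cy = a) is left H then (projT1 (cid H)).2 else fun _ _ => [::].
have eF c y : e (F (c, y)) = y.
  rewrite /e; case: pselect => [H|[]]; last by exists (c, y).
  by case: (cid H) => cy /= /Finj ->.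
exists e => y b; apply: contrapT => nob; apply: ordinal_uncountable.
apply: (@sub_countable _ _ _ [set c | ~~ lt b c]); last exact: initial_countable.
apply: (@injection_card_le _ _ _ (fun c => F (c, y))).
  by move=> c c' /Finj[].
by move=> c _; apply/negP => h; apply: nob; exists (F (c, y)).
Qed.

End ContinuumOrdinal.

(** The properties of Phi from which those of the group are derived: independence
of the columns, property (P), HFD, accumulation points for sequences in the k-th
power, and avoidance. *)
Definition generic_matrix (T : eqType) (lt : rel T) k (Phi : T -> T -> bool) :=
  [/\ forall v, (exists b, coef b v) -> exists a, parity (Phi a) v,
    forall (a : nat -> T) (q : T -> bool), exists x, forall n, Phi (a n) x = q (a n),
    forall z : nat -> seq T, (forall m n, same_vec (z m) (z n) -> m = n) ->
      exists b, forall (F : seq T) (w : T -> bool), {in F, forall a, ~~ lt a b} ->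
      exists n, {in F, forall a, parity (Phi a) (z n) = w a},
    forall J, uniq J -> size J <= k -> forall f : nat -> nat -> seq T,
      exists w : nat -> seq T, forall F : seq T, infinite_set
      [set n | {in F, forall a, {in J, forall i,
        parity (Phi a) (f n i) = parity (Phi a) (w i)}}] &
    forall y, independent_mod (y 0) (targets k y) -> exists a, avoids k (Phi a) y].

Lemma generic_matrix_exists (I : Type) (le : rel I) k :
  continuum_hypothesis -> continuum_ordinal le -> 0 < k ->
  exists Phi : I -> I -> bool, @generic_matrix {classic I} (strict le) k Phi.
Proof.
move=> CH leI k0.
have [e e_cofinal] := ordinal_enumeration CH leI.
have wf := ordinal_lt_wf leI; have irr := @ordinal_lt_irr _ le.
have tr := ordinal_lt_trans leI; have tot := ordinal_lt_total leI.
have cnt := ordinal_lt_countable CH leI; have bnd := ordinal_lt_bounded CH leI.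
have [x0 _] : exists x0 : {classic I}, True.
  have [_ + _] := leI; rewrite card_eq_le => /andP[_ /card_le_injection[g _ _]].
  by exists (g set0).
have [Phi PhiP] := rows_exist k e wf cnt.
exists Phi; split.
- exact: (separate_vector x0 tr bnd e_cofinal PhiP).
- exact: (prescribe_coordinates irr tr bnd e_cofinal PhiP).
- by move=> z zinj; exact: (hfd_sequence x0 wf tr tot bnd e_cofinal PhiP).
- exact: (accumulation_exists x0 wf irr tr tot cnt bnd e_cofinal PhiP).
- exact: (avoid_exists x0 tr bnd e_cofinal PhiP).
Qed.

(** * Neighbourhoods in powers of subgroups of the cube *)

(** The sets containing such a box form a filter which converges to [p] in every
coordinate, hence in the product. *)
Lemma nbhs_prod_basis (J : Type) (X : J -> topologicalType)
    (p : prod_topology X) (O : set (prod_topology X)) :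
  nbhs p O -> exists (F : seq {classic J}) (V : forall j, set (X j)),
    (forall j, nbhs (p j) (V j)) /\
    forall q : prod_topology X, (forall j : {classic J}, j \in F -> V j (q j)) -> O q.
Proof.
pose Fil : set_system (prod_topology X) := [set O |
  exists (F : seq {classic J}) (V : forall j, set (X j)),
    (forall j, nbhs (p j) (V j)) /\
    forall q : prod_topology X, (forall j : {classic J}, j \in F -> V j (q j)) -> O q].
have FilF : Filter Fil.
  split.
  - by exists [::], (fun=> setT); split => // j; exact: filterT.
  - move=> A B [F [V [pV VA]]] [G [W [pW WB]]].
    exists (F ++ G), (fun j => V j `&` W j); split=> [j|q FGq]; first exact: filterI.
    split; [apply: VA|apply: WB] => j jF.
      by have [] := FGq j; rewrite ?mem_cat ?jF.
    by have [] := FGq j; rewrite ?mem_cat ?jF ?orbT.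
  - by move=> A B AB [F [V [pV VA]]]; exists F, V; split=> // q /VA/AB.
suff : Fil --> p by apply.
apply/cvg_sup => j A; rewrite nbhsE => -[_ [[B Bop <-] Bp] sub].
exists [:: j : {classic J}],
  (@eqtype.dfwith {classic J} (fun j => set (X j)) (fun=> setT) j B).
split=> [i|q qV].
  have [ji|ji] := eqVneq (j : {classic J}) i; last by rewrite dfwith_out//; exact: filterT.
  by case: _ / ji; rewrite dfwith_in; exact: open_nbhs_nbhs.
by apply: sub; have := qV j (mem_head _ _); rewrite dfwith_in.
Qed.

Lemma nbhs_prod_coord (J : Type) (X : J -> topologicalType) (p : prod_topology X)
    (j : J) (V : set (X j)) :
  nbhs (p j) V -> nbhs p [set q : prod_topology X | V (q j)].
Proof. exact: (@proj_continuous {classic J} X j p). Qed.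

Lemma nbhs_cube_basis (J : Type) (p : cube J) (O : set (cube J)) :
  nbhs p O -> exists F : seq {classic J},
    forall q : cube J, {in F, forall j, q j = p j} -> O q.
Proof.
move=> /nbhs_prod_basis[F [V [pV VO]]]; exists F => q qF.
by apply: VO => j jF; rewrite qF//; exact: nbhs_singleton.
Qed.

Lemma nbhs_cube_coord (J : Type) (p : cube J) (j : J) :
  nbhs p [set q : cube J | q j = p j].
Proof.
apply: (@nbhs_prod_coord J (fun=> bool) p j [set p j]).
by apply: open_nbhs_nbhs; split=> //; exact: discrete_open.
Qed.

Section SubspacePower.
Variables (J : Type) (G : set (cube J)).

Lemma nbhs_subspace_basis (t : set_type G) (O : set (set_type G)) :
  nbhs t O -> exists F : seq {classic J},
    forall u : set_type G, {in F, forall j, (\val u : cube J) j = (\val t : cube J) j} -> O u.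
Proof.
rewrite nbhsE => -[_ [[B Bop <-] Bt] sub].
have [F FB] := nbhs_cube_basis (open_nbhs_nbhs (conj Bop Bt)).
by exists F => u uF; apply: sub; exact: FB.
Qed.

Lemma nbhs_subspace_coord (t : set_type G) (j : J) :
  nbhs t [set u : set_type G | (\val u : cube J) j = (\val t : cube J) j].
Proof. exact: (@initial_continuous _ _ _ t _ (nbhs_cube_coord _ j)). Qed.

Lemma nbhs_subspace_coords (t : set_type G) (F : seq {classic J}) :
  nbhs t [set u : set_type G | {in F, forall j, (\val u : cube J) j = (\val t : cube J) j}].
Proof.
elim: F => [|j F IH]; first by apply: filterS filterT => u _ j.
apply: filterS (filterI (nbhs_subspace_coord t j) IH) => u [/= uj uF] c.
by rewrite inE => /predU1P[->//|/uF].
Qed.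

Lemma nbhs_power_basis k (t : power_space (set_type G) k) (O : set _) :
  nbhs t O -> exists F : seq {classic J},
    forall u : power_space (set_type G) k,
      (forall i, {in F, forall j, (\val (u i) : cube J) j = (\val (t i) : cube J) j}) -> O u.
Proof.
move=> /nbhs_prod_basis[S [V [tV VO]]].
have /choice[F FV] i := nbhs_subspace_basis (tV i).
exists (flatten [seq F i | i <- enum 'I_k]) => u uF; apply: VO => i _.
apply: FV => j jF; apply: uF; apply/flattenP; exists (F i) => //.
by apply: map_f; rewrite mem_enum.
Qed.

Lemma nbhs_power_coord k (t : power_space (set_type G) k) (F : seq {classic J}) :
  nbhs t [set u : power_space (set_type G) k |
    forall i, {in F, forall j, (\val (u i) : cube J) j = (\val (t i) : cube J) j}].
Proof.
apply: (@filter_forall _ _ (fun i (u : power_space (set_type G) k) =>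
  {in F, forall j, (\val (u i) : cube J) j = (\val (t i) : cube J) j})
  (nbhs t) (nbhs_filter t)) => i.
exact: (@nbhs_prod_coord 'I_k (fun=> set_type G) t i _ (nbhs_subspace_coords (t i) F)).
Qed.

End SubspacePower.

(** * The group generated by the columns *)

Section GeneratedGroup.
Variables (I : Type) (le : rel I) (k : nat).
Let T : eqType := {classic I}.
Variable Phi : T -> T -> bool.
Hypothesis PhiP : @generic_matrix T (strict le) k Phi.
Hypothesis CH : continuum_hypothesis.
Hypothesis leI : continuum_ordinal le.

Definition generator (x : T) : cube I := fun a : T => Phi a x.

Definition vec (s : seq T) : cube I := fun a : T => parity (Phi a) s.

Local Notation G := (subgroup_generated (range generator)).

Lemma vec_cat s t : vec (s ++ t) = (vec s + vec t)%R.
Proof. by apply/funext => a; rewrite /vec parity_cat. Qed.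

Lemma vec_sub s t : vec (s ++ t) = (vec s - vec t)%R.
Proof. by apply/funext => a; rewrite /vec parity_cat. Qed.

Lemma vec1 x : vec [:: x] = generator x.
Proof. by apply/funext => a; rewrite /vec parity_cons addbF. Qed.

Lemma generated_vec : G = range vec.
Proof.
apply/seteqP; split.
  apply: smallest_sub => [|_ [x _ <-]]; last by exists [:: x]; rewrite ?vec1.
  split=> [|_ _ /set_mem[s _ <-] /set_mem[t _ <-]]; apply/mem_set.
    by exists [::].
  by exists (s ++ t) => //; exact: vec_sub.
move=> _ [s _ <-] H [[H0 HB] Hgen].
elim: s => [|x s IH]; first exact/set_mem.
apply/set_mem; rewrite -cat1s vec_sub vec1; apply: HB; apply/mem_set => //.
by apply: Hgen; exists x.
Qed.

Lemma in_generated s : G (vec s).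
Proof. by rewrite generated_vec; exists s. Qed.

Lemma vec_eq0 s : vec s = 0%R -> same_vec s [::].
Proof.
move=> s0 b; apply/negbTE/negP => sb; have [sep _ _ _ _] := PhiP.
have [a] : exists a, parity (Phi a) s by apply: sep; exists b.
by have := congr1 (fun f : cube I => f a) s0; rewrite /vec => ->.
Qed.

Lemma generator_inj : injective generator.
Proof.
move=> x y xy; have /vec_eq0/(_ y) : vec [:: x; y] = 0%R.
  by rewrite -cat1s vec_sub !vec1 xy subrr.
by rewrite !coef_cons eqxx /= addbT => /negbFE/eqP.
Qed.

Lemma generators_independent : linearly_independent (range generator).
Proof.
move=> n v a vinj vx va0 i; apply/negbTE/negP => ai.
have /choice[c cv] j : exists c, generator c = v j by have [c _ <-] := vx j; exists c.
pose s : seq T := [seq c i | i <- index_enum 'I_n & a i].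
have su : uniq s.
  rewrite map_inj_uniq ?filter_uniq ?index_enum_uniq// => j j' jj.
  by apply: vinj; rewrite -!cv jj.
have s0 : vec s = 0%R.
  rewrite -va0 /s; elim: (index_enum _) => [|j r IH]; first by rewrite big_nil.
  rewrite big_cons -IH -cv /=; case: (a j) => /=.
    by rewrite -cat1s vec_cat vec1; congr (_ + _)%R; rewrite scale1r.
  by rewrite scale0r add0r.
have := vec_eq0 s0 (c i); rewrite /coef /parity count_uniq_mem// map_f//.
by rewrite mem_filter ai mem_index_enum.
Qed.

Lemma index_infinite : infinite_set [set: T].
Proof. by move=> /finite_set_countable; exact: ordinal_uncountable leI. Qed.

(** A single generator already realizes any pattern on countably many
coordinates. *)
Lemma generated_property_P : property_P G.
Proof.
move=> J JN; have [x0 _] := infinite_setN0 index_infinite.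
have [_ pre _ _ _] := PhiP.
have [|s sJ] := @countable_sequence T x0 J; first by rewrite (eq_countable JN).
apply/seteqP; split=> // q _.
have [x xP] := pre s (fun b =>
  if pselect (J b) is left H then q (exist _ b (mem_set H)) else false).
exists (generator x); first by rewrite -vec1; exact: in_generated.
apply/functional_extensionality_dep => j; rewrite /Defs.restrict /generator.
have Jj := set_valP j; have [n nj] := sJ _ Jj.
transitivity (Phi (s n) x); first by rewrite nj.
rewrite xP nj; case: pselect => // H.
by congr q; exact: val_inj.
Qed.

Lemma generated_hfd : hereditarily_finally_dense le G.
Proof.
have [_ _ hfd _ _] := PhiP; split.
  move=> Gfin; apply: index_infinite.
  have gT : generator @` [set: T] #= [set: T].
    by apply: inj_card_eq; apply: in2W; exact: generator_inj.
  rewrite -(eq_finite_set gT); apply: sub_finite_set Gfin => _ [x _ <-].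
  by rewrite -vec1; exact: in_generated.
move=> Z ZG /infinite_injection[z zinj zZ].
have /choice[s sz] n : exists s, vec s = z n.
  by have := ZG _ (zZ n); rewrite generated_vec => -[s _ <-]; exists s.
have [m n mn|b bP] := hfd s.
  apply: zinj; rewrite -!sz; apply/funext => a; exact: same_vec_parity.
exists b => O [q Oq] Oop.
have [F [V [qV VO]]] := nbhs_prod_basis (open_nbhs_nbhs (conj Oop Oq)).
pose w (a : T) := if pselect (le b a) is left H then q (exist _ a (mem_set H)) else false.
have [|n nF] := bP [seq (\val j : T) | j <- F] w.
  move=> _ /mapP[j _ ->]; have bj : le b (\val j) := set_valP j.
  apply/negP => jb; have : strict le b (\val j).
    by rewrite /strict bj andbT eq_sym; case/andP: jb.
  move=> /(ordinal_lt_trans leI jb).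
  by rewrite ordinal_lt_irr.
exists (Defs.restrict (J := [set a | le b a]) (z n)); split; last by exists (z n).
apply: VO => j jF.
suff -> : Defs.restrict (J := [set a | le b a]) (z n) j = q j by exact: nbhs_singleton.
rewrite /Defs.restrict -sz; transitivity (w (\val j)); first exact: nF (map_f _ jF).
rewrite /w; case: pselect => [H|[]]; last exact: (set_valP j).
by congr q; exact: val_inj.
Qed.

Lemma vec_choice : exists rep : cube I -> seq T, forall y, G y -> vec (rep y) = y.
Proof.
have /choice[rep repP] y : exists s, G y -> vec s = y.
  have [Gy|nG] := pselect (G y); last by exists [::].
  by move: (Gy); rewrite generated_vec => -[s _ <-]; exists s.
by exists rep.
Qed.

Lemma generated_power_countably_compact : countably_compact (power_space (set_type G) k).
Proof.
have [_ _ _ acc _] := PhiP; have [rep repP] := vec_choice.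
move=> A /infinite_injection[s sinj sA].
pose f n i := if insub i is Some j then rep (\val (s n (j : 'I_k))) else [::].
have [|w wP] := acc (iota 0 k) (iota_uniq _ _) _ f; first by rewrite size_iota.
pose t : power_space (set_type G) k :=
  fun i : 'I_k => exist _ (vec (w i)) (mem_set (in_generated (w i))).
exists t => O /nbhs_power_basis[F FO].
have : infinite_set ([set n | {in F, forall a, {in iota 0 k, forall i,
    parity (Phi a) (f n i) = parity (Phi a) (w i)}}] `\` [set n | s n = t]).
  apply: infinite_setD; first exact: wP.
  have [[n0 n0t]|no] := pselect (exists n, s n = t).
    by apply: sub_finite_set (finite_set1 n0) => n nt; apply: sinj; rewrite n0t.
  by apply: sub_finite_set (finite_set0 nat) => n nt; apply: no; exists n.
move=> /infinite_setN0[n [nF nt]]; exists (s n); split=> //; first exact/eqP.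
apply: FO => i a aF; rewrite -[RHS]/(parity (Phi a) (w i)).
have := nF a aF i; rewrite mem_iota ltn_ord => /(_ isT).
rewrite /f valK => <-.
by rewrite -[in LHS](repP (\val (s n i)))//; exact: set_valP.
Qed.

(** The sets [U n] put the sequence [y 0] of all components of the chosen points
in echelon form with respect to the coordinates [cd j]; see [tri].  If the
accumulation point [t] has a coordinate [cd j] equal to 1, only the first few
points can agree with it there.  Otherwise [y 0] is independent modulo the
components of [t], and one coordinate separates [t] from all chosen points. *)
Lemma generated_power_not_selectively_pseudocompact :
  ~ selectively_pseudocompact (power_space (set_type G) k.+1).
Proof.
have [_ pre _ _ avoid] := PhiP; have [rep repP] := vec_choice.
have [cd cdinj _] := infinite_injection index_infinite.
pose U n : set (power_space (set_type G) k.+1) := [set z |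
  forall (i : 'I_k.+1) j, j < n.+1 * k.+1 ->
    (\val (z i) : cube I) (cd j) = (j == n * k.+1 + i)].
have lt_block n (i : 'I_k.+1) : n * k.+1 + i < n.+1 * k.+1.
  by rewrite mulSn addnC ltn_add2r.
move=> /(_ U)[].
- move=> n; rewrite openE => z Uz.
  apply: filterS (nbhs_power_coord z [seq cd j | j <- iota 0 (n.+1 * k.+1)]) => u uz i j jn.
  by rewrite uz ?Uz//; apply: map_f; rewrite mem_iota.
- move=> n; have /choice[c cP] (i : 'I_k.+1) := pre cd (fun a => a == cd (n * k.+1 + i)).
  exists (fun i => exist _ (vec [:: c i]) (mem_set (in_generated [:: c i]))) => i j _ /=.
  by rewrite vec1 /generator cP (inj_eq cdinj).
- have disj m n z : m < n -> U m z -> U n z -> False.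
    move=> mn /(_ ord0 (m * k.+1 + 0)) Um /(_ ord0 (m * k.+1 + 0)) Un.
    have := Um (lt_block m ord0); rewrite Un ?eqxx.
      by rewrite !addn0 eqn_pmul2r// ltn_eqF.
    by apply: ltn_trans (lt_block m ord0) _; rewrite ltn_pmul2r.
  apply/trivIsetP => m n _ _ mn; apply/seteqP; split=> // z [Um Un].
  by case: (ltngtP m n) mn => // h _; [exact: disj h Um Un|exact: disj h Un Um].
move=> z zU [t tlim].
pose y (c l : nat) := if c is 0 then rep (\val (z (l %/ k.+1) (inord (l %% k.+1))))
  else rep (\val (t (inord l))).
have y0 n (i : 'I_k.+1) : vec (y 0 (n * k.+1 + i)) = \val (z n i).
  rewrite /y divnMDl// divn_small// addn0 modnMDl modn_small// inord_val.
  by apply: repP; exact: set_valP.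
have y1 (i : 'I_k.+1) : vec (y 1 i) = \val (t i).
  by rewrite /y inord_val; apply: repP; exact: set_valP.
have nlim (W : set (power_space (set_type G) k.+1)) m : nbhs t W ->
    exists2 n, m <= n & W (z n).
  move=> tW.
  (* The finitely many points before [m] which differ from [t] are excluded by
     one coordinate each. *)
  suff [W' tW' W'z] : exists2 W', nbhs t W' & forall n, n < m -> W' (z n) -> z n = t.
    have [u [ut [n _ zn] [Wn W'n]]] := tlim _ (filterI tW tW').
    rewrite -zn in ut Wn W'n; exists n => //; rewrite leqNgt; apply/negP => nm.
    by move/eqP: ut; apply; exact: W'z.
  elim: m => [|m [W' tW' IH]]; first by exists setT => //; exact: filterT.
  have [zt|zt] := pselect (z m = t).
    by exists W' => // n; rewrite ltnS leq_eqVlt => /predU1P[->//|]; exact: IH.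
  have [i [a zta]] : exists i a, (\val (z m i) : cube I) a <> (\val (t i) : cube I) a.
    apply: contrapT => h; apply: zt; apply/functional_extensionality_dep => i.
    apply/val_inj/funext => a; apply: contrapT => za; apply: h; by exists i, a.
  exists (W' `&` [set u : power_space (set_type G) k.+1 |
     forall i, {in [:: a : T], forall j, (\val (u i) : cube I) j = (\val (t i) : cube I) j}]).
    by apply: filterI => //; exact: nbhs_power_coord.
  move=> n; rewrite ltnS leq_eqVlt => /predU1P[->|nm] [W'n Wn]; last exact: IH.
  by case: zta; apply: Wn; rewrite mem_head.
have tri l j : j <= l -> parity (Phi (cd j)) (y 0 l) = (j == l).
  move=> jl; pose i : 'I_k.+1 := inord (l %% k.+1).
  have li : l %/ k.+1 * k.+1 + i = l by rewrite inordK ?ltn_mod// -divn_eq.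
  rewrite -[LHS]/(vec (y 0 l) (cd j)) -li y0 zU//.
  by rewrite (leq_ltn_trans jl)// -{1}li lt_block.
have [[i [j tij]]|t0] := pselect (exists i j, (\val (t i) : cube I) (cd j)).
  have [n jn /(_ i (cd j) (mem_head _ _))] := nlim _ j.+1 (nbhs_power_coord t [:: cd j]).
  have jnk : j < n * k.+1 + i.
    by rewrite (leq_trans jn)// (leq_trans (leq_pmulr _ (ltn0Sn k)))// leq_addr.
  rewrite tij zU; first by rewrite ltn_eqF.
  exact: ltn_trans jnk (lt_block n i).
(* The first nonzero coefficient [j] of a relation would be seen at coordinate
   [cd j], where the components of [t] and all later terms vanish. *)
have ind : independent_mod (y 0) (targets k y).
  move=> s c cH sc.
  have s0 j : parity (fun l => parity (Phi (cd j)) (y 0 l)) s = false.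
    have := same_vec_parity (Phi (cd j)) sc; rewrite parity_cat parity_lin.
    suff -> : parity (Phi (cd j)) (flatten c) = false by rewrite addbF.
    elim: c cH {sc} => // h c IH cH; rewrite /= parity_cat IH ?addbF; last first.
      by move=> x xc; apply: cH; rewrite inE xc orbT.
    have /mapP[i] := cH h (mem_head _ _); rewrite mem_iota => ik ->.
    rewrite -[LHS]/(vec (y 1 (Ordinal ik)) (cd j)) y1.
    by apply/negbTE/negP => tij; apply: t0; exists (Ordinal ik), j.
  move=> j; rewrite coef_nil; elim/ltn_ind: j => j IH.
  rewrite -(s0 j); apply: eq_parity => l sl.
  have jl : j <= l by rewrite leqNgt; apply/negP => /IH; rewrite sl.
  by rewrite tri// eq_sym.
have [a [ah ag]] := avoid _ ind.
have [n _ na] := nlim _ 0 (nbhs_power_coord t [:: a]).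
have [i ik] := ag n; rewrite -[parity _ _]/(vec (y 0 (n * k.+1 + Ordinal ik)) a) y0.
rewrite na ?mem_head// -y1 /vec ah//.
by apply/mapP; exists i => //; rewrite mem_iota.
Qed.

End GeneratedGroup.

(** * Subgroups of the cube as topological groups *)

Lemma subgroup_generated_closed (V : zmodType) (S : set V) :
  zmod_closed [in subgroup_generated S].
Proof.
split=> [|u v /set_mem uS /set_mem vS]; apply/mem_set => H HS.
  by have [[H0 _] _] := HS; exact/set_mem.
have [[_ HB] _] := HS; apply/set_mem/HB; apply/mem_set; [exact: uS|exact: vS].
Qed.

Section SubgroupOfCube.
Variables (I : Type) (S : set (cube I)).

Definition cube_subgroup : Type := set_type (subgroup_generated S).

HB.instance Definition _ := Topological.copy cube_subgroup (set_type (subgroup_generated S)).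

Let sub_in (u v : cube_subgroup) :
  (\val u - \val v : cube I)%R \in subgroup_generated S.
Proof. by apply: (subgroup_generated_closed S).2; apply/mem_set; exact: set_valP. Qed.

Definition cube_subgroup_one : cube_subgroup :=
  exist _ (0%R : cube I) (subgroup_generated_closed S).1.

(** Since the cube has exponent 2, subtraction is the group law and every element
is its own inverse. *)
Definition cube_subgroup_mul (u v : cube_subgroup) : cube_subgroup :=
  exist _ (\val u - \val v : cube I)%R (sub_in u v).

Let mulE (u v : cube_subgroup) a :
  (\val (cube_subgroup_mul u v) : cube I) a = (\val u : cube I) a (+) (\val v : cube I) a.
Proof. by []. Qed.

Let ext_eq (u v : cube_subgroup) :
  (forall a, (\val u : cube I) a = (\val v : cube I) a) -> u = v.
Proof. by move=> h; apply/val_inj/funext. Qed.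

Let mulA : associative cube_subgroup_mul.
Proof. by move=> u v w; apply: ext_eq => a; rewrite !mulE addbA. Qed.

Let mul1 : left_id cube_subgroup_one cube_subgroup_mul.
Proof. by move=> u; apply: ext_eq => a; rewrite mulE. Qed.

Let mulr1 : right_id cube_subgroup_one cube_subgroup_mul.
Proof. by move=> u; apply: ext_eq => a; rewrite mulE addbF. Qed.

Let mulV : left_inverse cube_subgroup_one id cube_subgroup_mul.
Proof. by move=> u; apply: ext_eq => a; rewrite mulE addbb. Qed.

HB.instance Definition _ := isGroup.Build cube_subgroup mulA mul1 mulr1 mulV mulV.

Let mul_continuous : continuous (fun x : cube_subgroup * cube_subgroup => (x.1 * x.2)%g).
Proof.
move=> [u v] O /nbhs_subspace_basis[F FO].
exists ([set u' : cube_subgroup | {in F, forall j, (\val u' : cube I) j = (\val u : cube I) j}],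
        [set v' : cube_subgroup | {in F, forall j, (\val v' : cube I) j = (\val v : cube I) j}]).
  split; exact: nbhs_subspace_coords.
move=> [u' v'] /= [u'u v'v]; apply: FO => j jF.
by rewrite !mulE; congr addb; [exact: u'u|exact: v'v].
Qed.

Let inv_continuous : continuous (fun x : cube_subgroup => (x^-1)%g).
Proof. by move=> u O. Qed.

HB.instance Definition _ :=
  PreTopologicalGroup_isTopologicalGroup.Build cube_subgroup mul_continuous inv_continuous.

Lemma cube_subgroup_hausdorff : hausdorff_space cube_subgroup.
Proof.
move=> u v uv; apply: ext_eq => a.
by have [w [<- <-]] := uv _ _ (nbhs_subspace_coord u a) (nbhs_subspace_coord v a).
Qed.

End SubgroupOfCube.

Theorem mainTheorem1 (CH : continuum_hypothesis) (k : nat) (k_gt0 : (0 < k)%N) :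
  (forall (I : Type) (le : rel I), continuum_ordinal le ->
     exists x : I -> cube I,
       let G : set (cube I) := subgroup_generated (range x) in
       [/\ injective x,
           linearly_independent (range x),
           hereditarily_finally_dense le G,
           property_P G &
           countably_compact (power_space (set_type G) k) /\
           ~ selectively_pseudocompact (power_space (set_type G) k.+1)])
  /\
  (exists H : topologicalGroupType,
     [/\ hausdorff_space H,
         countably_compact (power_space H k) &
         ~ selectively_pseudocompact (power_space H k.+1)]).
Proof.
have main (I : Type) (le : rel I) : continuum_ordinal le ->
     exists x : I -> cube I,
       let G : set (cube I) := subgroup_generated (range x) in
       [/\ injective x,
           linearly_independent (range x),
           hereditarily_finally_dense le G,
           property_P G &
           countably_compact (power_space (set_type G) k) /\
           ~ selectively_pseudocompact (power_space (set_type G) k.+1)].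
  move=> leI; have [Phi PhiP] := generic_matrix_exists CH leI k_gt0.
  exists (generator Phi); split.
  - exact: generator_inj PhiP.
  - exact: generators_independent PhiP.
  - exact: generated_hfd PhiP leI.
  - exact: generated_property_P PhiP leI.
  - split; first exact: generated_power_countably_compact PhiP.
    exact: generated_power_not_selectively_pseudocompact PhiP leI.
split=> //; have [I [le leI]] := continuum_ordinal_exists.
have [x [_ _ _ _ [cc nsp]]] := main I le leI.
exists (cube_subgroup (range x)); split=> //; exact: cube_subgroup_hausdorff.
Qed.
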